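(* Consider an $L$-layer holomorphic multilayer perceptron (as described in the context) whose activation functions satisfy $\overline{g_p(z)}=g_p(\overline z)$ for $p=1,\dots,L$, together with a training set of $N$ points and the sum-of-squares error function $E$. For $p\in\{1,\dots,L\}$ write $\mathbf w=\mathbf w^{(p-1)}$. Then the weight updates of the backpropagation algorithm with Newton's method are given by $$\Delta\mathbf w=\left(\mathcal H_{\mathbf w\mathbf w}-\mathcal H_{\overline{\mathbf w}\mathbf w}\mathcal H_{\overline{\mathbf w}\overline{\mathbf w}}^{-1}\mathcal H_{\mathbf w\overline{\mathbf w}}\right)^{-1}\left[\mathcal H_{\overline{\mathbf w}\mathbf w}\mathcal H_{\overline{\mathbf w}\overline{\mathbf w}}^{-1}\left(\frac{\partial E}{\partial\overline{\mathbf w}}\right)^*-\left(\frac{\partial E}{\partial\mathbf w}\right)^*\right],$$ where the Hessian matrices are computed as follows. (1) For $p=1,\dots,L$, the entries of $\mathcal H_{\mathbf w^{(p-1)}\mathbf w^{(p-1)}}$ are $$\frac{\partial}{\partial w^{(p-1)}_{ba}}\left(\frac{\partial E}{\partial w^{(p-1)}_{ji}}\right)^*=\frac1N\sum_{t=1}^N\gamma^{(p)}_{tjb}\,\overline{x^{(p-1)}_{ti}}\,x^{(p-1)}_{ta},\qquad j,b=1,\dots,K_p,\ i,a=1,\dots,K_{p-1},$$ where, for $t=1,\dots,N$, $\gamma^{(L)}_{tkl}=g_L'(\overline{y^{\mathrm{net}}_{tl}})\,g_L'(y^{\mathrm{net}}_{tl})$ if $k=l$ and $\gamma^{(L)}_{tkl}=0$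 if $k\ne l$ ($k,l=1,\dots,C$), and for $p=1,\dots,L-1$ and $j,b=1,\dots,K_p$, $$\gamma^{(p)}_{tjb}=\left[\sum_{\eta=1}^{K_{p+1}}\sum_{\beta=1}^{K_{p+1}}\gamma^{(p+1)}_{t\eta\beta}\,\overline{w^{(p)}_{\eta j}}\,w^{(p)}_{\beta b}\right]g_p'\left(\overline{(x^{(p)}_{tj})^{\mathrm{net}}}\right)g_p'\left((x^{(p)}_{tb})^{\mathrm{net}}\right).$$ (2) For $p=1,\dots,L$, the entries of $\mathcal H_{\overline{\mathbf w^{(p-1)}}\mathbf w^{(p-1)}}$ are $$\frac{\partial}{\partial\overline{w^{(p-1)}_{ba}}}\left(\frac{\partial E}{\partial w^{(p-1)}_{ji}}\right)^*=\frac1N\sum_{t=1}^N\left(\psi^{(p)}_{tjb}+\theta^{(p)}_{tjb}\right)\overline{x^{(p-1)}_{ti}}\;\overline{x^{(p-1)}_{ta}},\qquad j,b=1,\dots,K_p,\ i,a=1,\dots,K_{p-1},$$ where, for $t=1,\dots,N$: $\theta^{(L)}_{tkl}=(y_{tl}-d_{tl})\,g_L''(\overline{y^{\mathrm{net}}_{tl}})$ if $k=l$ and $0$ if $k\neq l$ ($k,l=1,\dots,C$); for $p=1,\dots,L-1$ and $j,b=1,\dots,K_p$, $$\theta^{(p)}_{tjb}=\begin{cases}\left[\sum_{\eta=1}^{K_{p+1}}E^{(p+1)}_{t\eta}\,\overline{w^{(p)}_{\eta j}}\right]g_p''\left(\overline{(x^{(p)}_{tj})^{\mathrm{net}}}\right)&\text{if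 }j=b,\\0&\text{if }j\ne b;\end{cases}$$ $\psi^{(L)}_{tkl}=0$ for $k,l=1,\dots,C$; and for $p=1,\dots,L-1$ and $j,b=1,\dots,K_p$, $$\psi^{(p)}_{tjb}=\left[\sum_{\eta=1}^{K_{p+1}}\sum_{\beta=1}^{K_{p+1}}\left(\psi^{(p+1)}_{t\eta\beta}\,\overline{w^{(p)}_{\beta b}}+\theta^{(p+1)}_{t\eta\beta}\,\overline{w^{(p)}_{\eta b}}\right)\overline{w^{(p)}_{\eta j}}\right]g_p'\left(\overline{(x^{(p)}_{tj})^{\mathrm{net}}}\right)g_p'\left(\overline{(x^{(p)}_{tb})^{\mathrm{net}}}\right).$$ Here the $E^{(p)}_{tj}$ are given recursively by $E^{(L)}_{tl}=(y_{tl}-d_{tl})\,g_L'(\overline{y^{\mathrm{net}}_{tl}})$ for $l=1,\dots,C$, and $E^{(p)}_{tj}=\left[\sum_{\alpha=1}^{K_{p+1}}E^{(p+1)}_{t\alpha}\,\overline{w^{(p)}_{\alpha j}}\right]g_p'\left(\overline{(x^{(p)}_{tj})^{\mathrm{net}}}\right)$ for $1\le p\le L-1$, $j=1,\dots,K_p$. (3) $\mathcal H_{\mathbf w^{(p-1)}\overline{\mathbf w^{(p-1)}}}=\overline{\mathcal H_{\overline{\mathbf w^{(p-1)}}\mathbf w^{(p-1)}}}$ and $\mathcal H_{\overline{\mathbf w^{(p-1)}}\overline{\mathbf w^{(p-1)}}}=\overline{\mathcal H_{\mathbf w^{(p-1)}\mathbf w^{(p-1)}}}$.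
   Context: Network. Fix $L\ge1$ and layer sizes $K_0=m,K_1,\dots,K_L=C$. For $p=1,\dots,L$ the activation function $g_p$ of layer $p$ is holomorphic on a domain $\Omega_p\subseteq\mathbb C$ (closed under complex conjugation, so that $\overline{g_p(z)}=g_p(\overline z)$ is meaningful on it). The complex weights into layer $p$ are $w^{(p-1)}_{ji}$, $j=1,\dots,K_p$ (target node), $i=1,\dots,K_{p-1}$ (source node). The training set is $\{(z_{t1},\dots,z_{tm},d_{t1},\dots,d_{tC}): t=1,\dots,N\}$, with complex inputs $z_{ti}$ and desired outputs $d_{tl}$. For each $t$, $x^{(0)}_{ti}=z_{ti}$, and for $p=1,\dots,L$, $$(x^{(p)}_{tj})^{\mathrm{net}}=\sum_{i=1}^{K_{p-1}}w^{(p-1)}_{ji}x^{(p-1)}_{ti},\qquad x^{(p)}_{tj}=g_p\left((x^{(p)}_{tj})^{\mathrm{net}}\right),$$ all net sums being in the corresponding $\Omega_p$. Write $y_{tl}=x^{(L)}_{tl}$ and $y^{\mathrm{net}}_{tl}=(x^{(L)}_{tl})^{\mathrm{net}}$. The error function is $E=\frac1N\sum_{t=1}^N\sum_{l=1}^C|y_{tl}-d_{tl}|^2$. Weight vectors. $\mathbf w^{(p-1)}$ is the column vector with component number $(j-1)K_{p-1}+i$ equal to $w^{(p-1)}_{ji}$. Derivatives. $\frac{\partial}{\partial w}=\frac12\left(\frac{\partial}{\partial u}-i\frac{\partial}{\partial v}\right)$ and $\frac{\partial}{\partial\overline w}=\frac12\left(\frac{\partial}{\partial u}+i\frac{\partial}{\partial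 v}\right)$ for $w=u+iv$ are Wirtinger derivatives. $\frac{\partial E}{\partial\mathbf w}$ and $\frac{\partial E}{\partial\overline{\mathbf w}}$ are row vectors of Wirtinger derivatives (the weights of the other layers being held fixed), and $^*$ is conjugate transpose (complex conjugation for scalars). Define $$\mathcal H_{\mathbf w\mathbf w}=\frac{\partial}{\partial\mathbf w}\left(\frac{\partial E}{\partial\mathbf w}\right)^*,\quad\mathcal H_{\overline{\mathbf w}\mathbf w}=\frac{\partial}{\partial\overline{\mathbf w}}\left(\frac{\partial E}{\partial\mathbf w}\right)^*,\quad\mathcal H_{\mathbf w\overline{\mathbf w}}=\frac{\partial}{\partial\mathbf w}\left(\frac{\partial E}{\partial\overline{\mathbf w}}\right)^*,\quad\mathcal H_{\overline{\mathbf w}\overline{\mathbf w}}=\frac{\partial}{\partial\overline{\mathbf w}}\left(\frac{\partial E}{\partial\overline{\mathbf w}}\right)^*,$$ where the derivative of a column vector is its Jacobian matrix. Thus for $\mathbf w=\mathbf w^{(p-1)}$ the entry in row $(j-1)K_{p-1}+i$ and column $(b-1)K_{p-1}+a$ of $\mathcal H_{\mathbf w\mathbf w}$ (resp. $\mathcal H_{\overline{\mathbf w}\mathbf w}$) is $\frac{\partial}{\partial w^{(p-1)}_{ba}}\left(\frac{\partial E}{\partial w^{(p-1)}_{ji}}\right)^*$ (resp. $\frac{\partial}{\partial\overline{w^{(p-1)}_{ba}}}\left(\frac{\partial E}{\partial w^{(p-1)}_{ji}}\right)^*$). Newton's method. The Newton weight update for layer weights $\mathbf w$ is by definition the vector $\Delta\mathbf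 w$ given by the displayed formula in terms of the four Hessian matrices and the gradients of $E$ (when the inverses occurring exist); backpropagation updates $\mathbf w^{(p-1)}(n+1)=\mathbf w^{(p-1)}(n)+\mu(n)\Delta\mathbf w^{(p-1)}$ with steplength $\mu(n)$, layer by layer starting from the output layer, each time using the current weights. *)

(* Defs.v *)
From mathcomp Require Import all_boot all_order all_algebra.
From mathcomp Require Import all_classical all_reals all_analysis.
From mathcomp Require Import complex.

Set Implicit Arguments.
Unset Strict Implicit.
Unset Printing Implicit Defensive.

Import Order.TTheory GRing.Theory Num.Theory.
Import numFieldNormedType.Exports.

Local Open Scope ring_scope.
Local Open Scope classical_set_scope.
Local Open Scope sesquilinear_scope.

(* The type R[i] carries no topology of its own; seen as a numClosedFieldType
   it receives the normed topology given by the modulus. *)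
Definition Cplx (R : realType) : numClosedFieldType := R[i].

Section ComplexDomains.
Context {R : realType}.
Implicit Types (D : set (Cplx R)) (f : Cplx R -> Cplx R).

Definition is_domain D := [/\ D !=set0, open D & connected D].

Definition conj_closed D := forall z, D z -> D z^*.

(* [derivable f z 1] is differentiability over the scalar field Cplx R. *)
Definition holomorphic_on D f := forall z, D z -> derivable f z 1.

End ComplexDomains.

Section Wirtinger.
Context {R : realType}.
Local Notation C := (Cplx R).

(* Derivative of a complex-valued function of a real variable. *)
Definition rderive (f : R -> C) (s : R) : C :=
  (((fun x => complex.Re (f x))^`() s) +i* ((fun x => complex.Im (f x))^`() s))%C.

Definition rderivable (f : R -> C) (s : R) : Prop :=
  derivable (fun x => complex.Re (f x)) s 1 /\
  derivable (fun x => complex.Im (f x)) s 1.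

Section Vector.
Context {n : nat}.
Implicit Types (F : 'cV[C]_n -> C) (k : 'I_n) (v : 'cV[C]_n).

(* F restricted to the lines through v along which the real part (resp. the
   imaginary part) of the k-th component varies. *)
Definition re_line F k v (s : R) : C := F (v + (s%:C)%C *: delta_mx k 0).
Definition im_line F k v (s : R) : C := F (v + ((s%:C)%C * 'i) *: delta_mx k 0).

Definition wirtinger F k v : C :=
  2^-1 * (rderive (re_line F k v) 0 - 'i * rderive (im_line F k v) 0).

Definition wirtinger_conj F k v : C :=
  2^-1 * (rderive (re_line F k v) 0 + 'i * rderive (im_line F k v) 0).

Definition wirtinger_derivable F k v : Prop :=
  rderivable (re_line F k v) 0 /\ rderivable (im_line F k v) 0.

Definition grad F v : 'rV[C]_n := \row_k wirtinger F k v.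
Definition grad_conj F v : 'rV[C]_n := \row_k wirtinger_conj F k v.

Definition jac m (G : 'cV[C]_n -> 'cV[C]_m) v : 'M[C]_(m, n) :=
  \matrix_(i, k) wirtinger (fun u => G u i 0) k v.
Definition jac_conj m (G : 'cV[C]_n -> 'cV[C]_m) v : 'M[C]_(m, n) :=
  \matrix_(i, k) wirtinger_conj (fun u => G u i 0) k v.

(* In the suffixes w stands for the weight vector and b for its conjugate, in
   the order of the subscripts of H: hess_bw is the derivative with respect to
   the conjugate of w of (dE/dw)^*. *)
Definition hess_ww F v : 'M[C]_n := jac (fun u => (grad F u)^t*) v.
Definition hess_bw F v : 'M[C]_n := jac_conj (fun u => (grad F u)^t*) v.
Definition hess_wb F v : 'M[C]_n := jac (fun u => (grad_conj F u)^t*) v.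
Definition hess_bb F v : 'M[C]_n := jac_conj (fun u => (grad_conj F u)^t*) v.

(* All the derivatives entering the gradients and the Hessians exist (the
   operators above take arbitrary values where a derivative does not exist). *)
Definition twice_wirtinger_derivable F v : Prop :=
  (\forall u \near v, forall k, wirtinger_derivable F k u) /\
  (forall k l, wirtinger_derivable (fun u => (wirtinger F k u)^*) l v /\
               wirtinger_derivable (fun u => (wirtinger_conj F k u)^*) l v).

Definition newton_schur F v : 'M[C]_n :=
  hess_ww F v - hess_bw F v *m invmx (hess_bb F v) *m hess_wb F v.

Definition newton_direction F v : 'cV[C]_n :=
  invmx (newton_schur F v) *m
    (hess_bw F v *m invmx (hess_bb F v) *m (grad_conj F v)^t* - (grad F v)^t*).

End Vector.
End Wirtinger.

(* Families indexed by p <= L, computed from the value at L down to 0. *)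
Section Backward.
Context (T : nat -> Type) (dflt : forall p, T p) (L : nat).
Context (top : T L) (step : forall p, T p.+1 -> T p).

(* n is the distance from p to L. The family dflt only makes the function total:
   it supplies the values for p > L. *)
Fixpoint descend (n p : nat) : T p :=
  if n is m.+1 then step (descend m p.+1) else dfwith dflt L top p.

Definition backward (p : nat) : T p := descend (L - p) p.

Lemma backward_top : backward L = top.
Proof. by rewrite /backward subnn /= dfwithin. Qed.

Lemma backward_step p : (p < L)%N -> backward p = step (backward p.+1).
Proof. by move=> pL; rewrite /backward -(subnSK pL). Qed.

End Backward.

Arguments backward T dflt L top step p : clear implicits.

Section Network.
Context {R : realType}.
Local Notation C := (Cplx R).

(* K p is the size of layer p, g p the activation function of layer p (g 0 is
   not used), and w p the matrix w^(p) of the weights from layer p into layer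
   p.+1, with row index the target node and column index the source node. *)
Context (K : nat -> nat) (g : nat -> C -> C).

Definition weights := forall p, 'M[C]_(K p.+1, K p).

Implicit Types (w : weights) (x : 'cV[C]_(K 0%N)).

Fixpoint layer w x (p : nat) : 'cV[C]_(K p) :=
  match p with
  | 0 => x
  | q.+1 => map_mx (g q.+1) (w q *m layer w x q)
  end.

(* The net sums (x^(p))^net; the input layer has none. *)
Definition net w x (p : nat) : 'cV[C]_(K p) :=
  match p with
  | 0 => 0
  | q.+1 => w q *m layer w x q
  end.

(* mxvec enumerates the entries row by row. *)
Definition weight_vector w q : 'cV[C]_(K q.+1 * K q) := (mxvec (w q))^T.

Definition set_weights w q (v : 'cV[C]_(K q.+1 * K q)) : weights :=
  dfwith w q (vec_mx v^T).

Section Error.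
Context (L N : nat) (z : 'I_N -> 'cV[C]_(K 0%N)) (d : 'I_N -> 'cV[C]_(K L)).

Definition error w : C :=
  N%:R^-1 * \sum_(t < N) \sum_(l < K L) `|layer w (z t) L l 0 - d t l 0| ^+ 2.

(* E as a function of the weight vector w^(q), the other layers being fixed. *)
Definition layer_error w q (v : 'cV[C]_(K q.+1 * K q)) : C :=
  error (set_weights w v).

(* The update by Newton's method of the weights w^(q), with steplength mu, at
   the current weights w. *)
Definition newton_update (mu : R) w q : weights :=
  let v := weight_vector w q in
  set_weights w (v + (mu%:C)%C *: newton_direction (layer_error w (q := q)) v).

End Error.

Section Coefficients.
Context (L : nat) (w : weights) (x : 'cV[C]_(K 0%N)).

Definition gamma : forall p, 'M[C]_(K p) :=
  backward (fun p => 'M[C]_(K p)) (fun p => 0) L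
    (\matrix_(k, l) if k == l
       then derive1 (g L) (net w x L l 0)^* * derive1 (g L) (net w x L l 0)
       else 0)
    (fun p G => \matrix_(j, b)
       ((\sum_eta \sum_beta G eta beta * (w p eta j)^* * w p beta b) *
        derive1 (g p) (net w x p j 0)^* * derive1 (g p) (net w x p b 0))).

Context (d : 'cV[C]_(K L)).

Definition error_signal : forall p, 'cV[C]_(K p) :=
  backward (fun p => 'cV[C]_(K p)) (fun p => 0) L
    (\col_l ((layer w x L l 0 - d l 0) * derive1 (g L) (net w x L l 0)^*))
    (fun p e => \col_j
       ((\sum_alpha e alpha 0 * (w p alpha j)^*) *
        derive1 (g p) (net w x p j 0)^*)).

Definition theta : forall p, 'M[C]_(K p) :=
  backward (fun p => 'M[C]_(K p)) (fun p => 0) L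
    (\matrix_(k, l) if k == l
       then (layer w x L l 0 - d l 0) * derive1n 2 (g L) (net w x L l 0)^*
       else 0)
    (fun p _ => \matrix_(j, b) if j == b
       then (\sum_eta error_signal p.+1 eta 0 * (w p eta j)^*) *
            derive1n 2 (g p) (net w x p j 0)^*
       else 0).

Definition psi : forall p, 'M[C]_(K p) :=
  backward (fun p => 'M[C]_(K p)) (fun p => 0) L 0
    (fun p P => \matrix_(j, b)
       ((\sum_eta \sum_beta
           (P eta beta * (w p beta b)^* +
            theta p.+1 eta beta * (w p eta b)^*) * (w p eta j)^*) *
        derive1 (g p) (net w x p j 0)^* * derive1 (g p) (net w x p b 0)^*)).

End Coefficients.
End Network.

(* Main.v *)
Require Import Defs.
From mathcomp Require Import all_boot all_order all_algebra.
From mathcomp Require Import all_classical all_reals all_analysis.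
From mathcomp Require Import complex.
From mathcomp Require Import ring lra zify.

(** When the weights into one layer vary, the net sums of this layer and of the
    later ones are holomorphic functions of these weights, and so is every
    output y_l. The error is, up to 1/N, the sum of the
    (y_l - d_l) (y_l - d_l)^*, in which the first factor is holomorphic and the
    second one antiholomorphic. Hence a derivative with respect to w acts on the
    first factor only, a derivative with respect to the conjugate of w on the
    second one only, and (up to 1/N and the sum over the training set) two
    successive derivatives give

      H_ww = sum_l (d_k y_l)^* d_m y_l,
      H_bw = sum_l (y_l - d_l) (d_m d_k y_l)^*,

    the two other Hessian matrices being the conjugates of these
    ([wjet_sqr_dist]). The chain rule expresses d_k y_l and d_m d_k y_l through
    the derivatives J and S of y_l, of first and second order, with respect to
    the net sums of a layer p; J and S satisfy backward recursions
    ([output_jac], [output_hess], [output_jet]). Conjugating these recursions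
    and summing over l yields those of the coefficients of the statement:
    gamma = sum_l J_l^* J_l, error_signal = sum_l (y_l - d_l) J_l^* and
    psi + theta = sum_l (y_l - d_l) S_l^* ([gammaE], [error_signalE],
    [psi_thetaE]). In each layer theta is the part due to the second
    derivative of the activation function of that layer, and psi the part
    inherited from the later layers; the symmetry of the activation functions
    turns the conjugate of g' at a net sum into g' at the conjugate net sum.

    Second derivatives of E involve second derivatives of the activation
    functions, which are only assumed to be complex differentiable at each
    point. Their derivatives are therefore shown to be holomorphic
    ([holomorphic_derivable_derive1]), by the classical route: Goursat's theorem
    for rectangles ([goursat]), Cauchy's formula for a rectangle
    ([cauchy_rint]), and differentiation of the Cauchy kernel under the integral
    sign ([cauchy_transform_is_derive]). *)

Set Implicit Arguments.
Unset Strict Implicit.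
Unset Printing Implicit Defensive.

Import Order.TTheory GRing.Theory Num.Theory.
Import numFieldNormedType.Exports.
Import ComplexField.Normc.

Local Open Scope ring_scope.
Local Open Scope classical_set_scope.
Local Open Scope sesquilinear_scope.

(** * The modulus and epsilon-delta characterizations in the plane *)

Section Modulus.
Context {R : realType}.
Local Notation C := (Cplx R).
Implicit Types z a h l : C.

(** The norm of the plane takes values in the plane itself, which is only
    partially ordered; estimates are carried out with its real part. *)
Definition cmod (z : C) : R := normc z.

Lemma normr_cmod z : `|z| = (cmod z)%:C%C. Proof. by []. Qed.

Lemma cmod_ge0 z : 0 <= cmod z.
Proof. by rewrite -ler0c -normr_cmod. Qed.

Lemma cmod0 : cmod 0 = 0. Proof. exact: normc0. Qed.

Lemma cmodN z : cmod (- z) = cmod z. Proof. exact: normcN. Qed.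

Lemma cmodB z a : cmod (z - a) = cmod (a - z).
Proof. by rewrite -cmodN opprB. Qed.

Lemma cmodM z a : cmod (z * a) = cmod z * cmod a. Proof. exact: normcM. Qed.

Lemma cmodV z : cmod z^-1 = (cmod z)^-1. Proof. exact: normcV. Qed.

Lemma cmodX z n : cmod (z ^+ n) = cmod z ^+ n.
Proof.
elim: n => [|n IH]; first exact: normc1.
by rewrite !exprS cmodM IH.
Qed.

Lemma ler_cmodD z a : cmod (z + a) <= cmod z + cmod a.
Proof. exact: le_normcD. Qed.

Lemma cmod_real (x : R) : cmod x%:C%C = `|x|.
Proof. by rewrite /cmod /= expr0n addr0 sqrtr_sqr. Qed.

Lemma cmodi : cmod 'i = 1.
Proof. by rewrite /cmod /= expr0n expr1n add0r sqrtr1. Qed.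

Lemma cmod_gt0 z : (0 < cmod z) = (z != 0).
Proof. by rewrite -normr_gt0 normr_cmod -ltcR. Qed.

Lemma normr_Re_le z : `|complex.Re z| <= cmod z.
Proof.
case: z => x y; rewrite /cmod /= -sqrtr_sqr ler_wsqrtr// lerDl; exact: sqr_ge0.
Qed.

Lemma normr_Im_le z : `|complex.Im z| <= cmod z.
Proof.
case: z => x y; rewrite /cmod /= -sqrtr_sqr ler_wsqrtr// lerDr; exact: sqr_ge0.
Qed.

Lemma cmod_le_ReIm z : cmod z <= `|complex.Re z| + `|complex.Im z|.
Proof.
rewrite [z in cmod z]complexE (le_trans (ler_cmodD _ _))// cmod_real lerD2l.
by rewrite cmodM cmodi mul1r cmod_real.
Qed.

Lemma nbhs_cmodP a (P : set C) :
  nbhs a P <-> exists2 e : R, 0 < e & forall z, cmod (z - a) < e -> P z.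
Proof.
split=> [/nbhs_normP[e /= e0 aP]|[e e0 aP]].
  have re : e = (complex.Re e)%:C%C by rewrite RRe_real// gtr0_real.
  exists (complex.Re e); first by rewrite -ltcR -re.
  by move=> z za; apply: aP; rewrite /= normr_cmod re ltcR cmodB.
apply/nbhs_normP; exists e%:C%C; first by rewrite /= ltcR.
by move=> z /=; rewrite normr_cmod ltcR cmodB; exact: aP.
Qed.

Lemma cvg_cmodP {T : Type} (F : set_system T) {FF : Filter F} (f : T -> C) a :
  f @ F --> a <-> forall e : R, 0 < e -> \forall x \near F, cmod (f x - a) < e.
Proof.
split=> [fa e e0|fa].
  by apply: (fa [set z | cmod (z - a) < e]); apply/nbhs_cmodP; exists e.
move=> P /nbhs_cmodP[e e0 aP].
by apply: filterS (fa e e0) => x; exact: aP.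
Qed.

(** Differentiability without division: the form in which it is composed,
    restricted to lines and integrated below. *)
Lemma is_derive_cmodP (f : C -> C) a l :
  is_derive a 1 f l <->
  forall e : R, 0 < e -> exists2 d : R, 0 < d &
    forall h, cmod h < d -> cmod (f (a + h) - f a - l * h) <= e * cmod h.
Proof.
have quot l' h : h != 0 -> cmod (f (a + h) - f a - l' * h) =
    cmod (h^-1 *: ((f \o shift a) (h *: 1) - f a) - l') * cmod h.
  move=> h0; rewrite -cmodM; congr cmod.
  rewrite /= [h *: 1]mulr1 (addrC h) [h^-1 *: _]/(h^-1 * _) mulrBl mulrAC mulVf//.
  by rewrite mul1r.
split=> [[df <-] e e0|fl].
  have /cvg_cmodP/(_ _ e0)/nbhs_cmodP[d d0 fd] := df.
  exists d => // h hd; have [->|h0] := eqVneq h 0.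
    by rewrite addr0 subrr mulr0 subrr cmod0 mulr0.
  rewrite quot// ler_wpM2r ?cmod_ge0// ltW//.
  by apply: fd; rewrite ?subr0.
suff fc : h^-1 *: ((f \o shift a) (h *: 1) - f a) @[h --> 0^'] --> l.
  by split; [apply/cvg_ex; exists l|exact/cvg_lim].
apply/cvg_cmodP => e e0; apply/nbhs_cmodP.
have [d d0 fd] := fl (e / 2) (divr_gt0 e0 (ltr0Sn _ 1)).
exists d => // h; rewrite subr0 => hd h0.
have h0' : 0 < cmod h by rewrite cmod_gt0.
by have := fd h hd; rewrite quot// ler_pM2r// => /le_lt_trans -> //; lra.
Qed.

End Modulus.

Arguments cmod : simpl never.

(** * Integrals of complex-valued functions of a real variable *)

Section ComplexIntegral.
Context {R : realType}.
Local Notation C := (Cplx R).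
Local Notation mu := (@lebesgue_measure R).
Implicit Types (a b : R) (phi psi : R -> C) (c : C).

Definition cint a b phi : C :=
  ((\int[mu]_(t in `[a, b]) complex.Re (phi t)) +i*
   (\int[mu]_(t in `[a, b]) complex.Im (phi t)))%C.

Definition continuous_itv a b phi :=
  forall t, a <= t <= b -> {for t, continuous phi}.

Lemma complex_ext (z w : C) :
  complex.Re z = complex.Re w -> complex.Im z = complex.Im w -> z = w.
Proof. by case: z w => x y [x' y'] /= -> ->. Qed.

Lemma continuous_Re phi (t : R) : {for t, continuous phi} ->
  {for t, continuous (fun x => complex.Re (phi x))}.
Proof.
move=> /cvg_cmodP phic; apply/cvgrPdist_lt => e e0.
apply: filterS (phic e e0) => x; rewrite cmodB.
by apply: le_lt_trans; rewrite -raddfB; exact: normr_Re_le.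
Qed.

Lemma continuous_Im phi (t : R) : {for t, continuous phi} ->
  {for t, continuous (fun x => complex.Im (phi x))}.
Proof.
move=> /cvg_cmodP phic; apply/cvgrPdist_lt => e e0.
apply: filterS (phic e e0) => x; rewrite cmodB.
by apply: le_lt_trans; rewrite -raddfB; exact: normr_Im_le.
Qed.

Lemma integrable_continuous a b (u : R -> R) :
  (forall t, a <= t <= b -> {for t, continuous u}) ->
  mu.-integrable `[a, b] (EFin \o u).
Proof.
move=> uc; apply: continuous_compact_integrable; first exact: segment_compact.
apply: continuous_in_subspaceT => t /set_mem /=; rewrite in_itv /=; exact: uc.
Qed.

Lemma integrable_Re a b phi : continuous_itv a b phi ->
  mu.-integrable `[a, b] (EFin \o (fun t => complex.Re (phi t))).
Proof.
by move=> phic; apply: integrable_continuous => t /phic; exact: continuous_Re.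
Qed.

Lemma integrable_Im a b phi : continuous_itv a b phi ->
  mu.-integrable `[a, b] (EFin \o (fun t => complex.Im (phi t))).
Proof.
by move=> phic; apply: integrable_continuous => t /phic; exact: continuous_Im.
Qed.

Lemma eq_cint a b phi psi : (forall t, a <= t <= b -> phi t = psi t) ->
  cint a b phi = cint a b psi.
Proof.
move=> phipsi; congr Complex; apply: eq_Rintegral => t /set_mem /=;
  by rewrite in_itv => /phipsi ->.
Qed.

Lemma cintD a b phi psi : continuous_itv a b phi -> continuous_itv a b psi ->
  cint a b (fun t => phi t + psi t) = cint a b phi + cint a b psi.
Proof.
move=> phic psic; apply: complex_ext; rewrite raddfD /=.
  rewrite -RintegralD//; try exact: integrable_Re.
  by apply: eq_Rintegral => t _; rewrite raddfD.
rewrite -RintegralD//; try exact: integrable_Im.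
by apply: eq_Rintegral => t _; rewrite raddfD.
Qed.

Lemma cintZ a b c phi : continuous_itv a b phi ->
  cint a b (fun t => c * phi t) = c * cint a b phi.
Proof.
move=> phic; case: c => u v; rewrite /cint.
have iZ (r : R) (h : R -> R) : mu.-integrable `[a, b] (EFin \o h) ->
    mu.-integrable `[a, b] (EFin \o (fun t => r * h t)).
  move=> ih; have -> : EFin \o (fun t => r * h t) =
    (fun t => r%:E * (EFin \o h) t)%E by apply/funext => t; rewrite /= EFinM.
  exact: integrableZl.
have [iR iI] := (integrable_Re phic, integrable_Im phic).
apply: complex_ext.
  transitivity (\int[mu]_(t in `[a, b])
      (u * complex.Re (phi t) - v * complex.Im (phi t))).
    by apply: eq_Rintegral => t _; case: (phi t).
  by rewrite RintegralB ?RintegralZl//; exact: iZ.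
transitivity (\int[mu]_(t in `[a, b])
    (u * complex.Im (phi t) + v * complex.Re (phi t))).
  by apply: eq_Rintegral => t _; case: (phi t).
by rewrite RintegralD ?RintegralZl//; exact: iZ.
Qed.

Lemma cint_cst a b c : a <= b -> cint a b (fun=> c) = (b - a)%:C%C * c.
Proof.
move=> ab; case: c => u v; rewrite /cint /= !Rintegral_cst//=.
rewrite lebesgue_measure_itv /= lte_fin.
have -> : fine (if a < b then (b%:E - a%:E)%E else 0%E) = b - a.
  by case: ltP => // ba; apply/esym/eqP; rewrite subr_eq0 eq_le ab ba.
by apply: complex_ext => /=; ring.
Qed.

Lemma Rintegral_split (u : R -> R) a b (e : R) : a <= b <= e ->
  mu.-integrable `[a, e] (EFin \o u) ->
  \int[mu]_(t in `[a, e]) u t =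
  \int[mu]_(t in `[a, b]) u t + \int[mu]_(t in `[b, e]) u t.
Proof.
move=> /andP[ab bc] iu.
have := Rintegral_itvB iu (x := b); rewrite !bnd_simp => /(_ ab bc) /eqP.
rewrite subr_eq addrC => /eqP ->; congr (_ + _).
apply: Rintegral_itv_obnd_cbnd; apply: integrableS iu => //.
by move=> t /=; rewrite !in_itv /= => /andP[/ltW bt ->]; rewrite (le_trans ab).
Qed.

Lemma cint_split a b e phi : a <= b <= e -> continuous_itv a e phi ->
  cint a e phi = cint a b phi + cint b e phi.
Proof.
move=> abe phic; apply: complex_ext; rewrite raddfD /=;
  apply: Rintegral_split => //; [exact: integrable_Re|exact: integrable_Im].
Qed.

Lemma normr_Rintegral_le a b (u : R -> R) (M : R) : a <= b ->
  mu.-integrable `[a, b] (EFin \o u) ->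
  (forall t, a <= t <= b -> `|u t| <= M) ->
  `|\int[mu]_(t in `[a, b]) u t| <= M * (b - a).
Proof.
move=> ab iu uM; rewrite (le_trans (le_normr_Rintegral _ iu))//.
have -> : M * (b - a) = \int[mu]_(t in `[a, b]) M.
  rewrite Rintegral_cst//= lebesgue_measure_itv /= lte_fin; congr (_ * _).
  by case: ltP => // ba; apply/eqP; rewrite subr_eq0 eq_le ab ba.
apply: le_Rintegral => //; first exact: integrable_norm.
by apply: integrable_continuous => t _; exact: cvg_cst.
Qed.

(** The factor 2, due to bounding the real and the imaginary part separately,
    is harmless: only orders of magnitude matter. *)
Lemma cmod_cint_le a b phi (M : R) : a <= b -> continuous_itv a b phi ->
  (forall t, a <= t <= b -> cmod (phi t) <= M) ->
  cmod (cint a b phi) <= 2 * M * (b - a).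
Proof.
move=> ab phic phiM; rewrite (le_trans (cmod_le_ReIm _))//.
rewrite -mulrA mulr_natl mulr2n lerD//; apply: normr_Rintegral_le => //.
- exact: integrable_Re.
- by move=> t /phiM; apply: le_trans; exact: normr_Re_le.
- exact: integrable_Im.
- by move=> t /phiM; apply: le_trans; exact: normr_Im_le.
Qed.

End ComplexIntegral.

Arguments cint : simpl never.

(** * Line integrals along the boundary of a rectangle *)

Section RectangleIntegral.
Context {R : realType}.
Local Notation C := (Cplx R).
Implicit Types (f g : C -> C) (c : C) (x y : R).

Definition rect x1 x2 y1 y2 : set C :=
  [set z | x1 <= complex.Re z <= x2 /\ y1 <= complex.Im z <= y2].

Definition frame x1 x2 y1 y2 : set C :=
  [set z | rect x1 x2 y1 y2 z /\
    [\/ complex.Re z = x1, complex.Re z = x2,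
        complex.Im z = y1 | complex.Im z = y2]].

(** Continuity in the whole plane at each point of D, which is stronger than
    continuity of the restriction to D. *)
Definition continuous_over (D : set C) f := forall z, D z -> {for z, continuous f}.

(** The line integral of f along the boundary of a rectangle. Opposite sides
    are subtracted under the integral sign, so that the integrands of affine
    functions are constant. *)
Definition rint f x1 x2 y1 y2 : C :=
  cint x1 x2 (fun t => f (t +i* y1)%C - f (t +i* y2)%C) +
  'i * cint y1 y2 (fun t => f (x2 +i* t)%C - f (x1 +i* t)%C).

Lemma continuous_hline (y t : R) :
  {for t, continuous (fun s : R => (s +i* y)%C : C)}.
Proof.
apply/cvg_cmodP => e e0.
have : \forall s \near t, `|t - s| < e by apply/nbhs_normP; exists e.
apply: filterS => s; rewrite distrC.
suff -> : ((s +i* y)%C : C) - (t +i* y)%C = (s - t)%:C%C by rewrite cmod_real.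
by apply: complex_ext; rewrite raddfB //= subrr.
Qed.

Lemma continuous_vline (x t : R) :
  {for t, continuous (fun s : R => (x +i* s)%C : C)}.
Proof.
apply/cvg_cmodP => e e0.
have : \forall s \near t, `|t - s| < e by apply/nbhs_normP; exists e.
apply: filterS => s; rewrite distrC.
suff -> : ((x +i* s)%C : C) - (x +i* t)%C = 'i * (s - t)%:C%C.
  by rewrite cmodM cmodi mul1r cmod_real.
by apply: complex_ext; rewrite raddfB //= ?subrr; ring.
Qed.

Section Frame.
Variables (x1 x2 y1 y2 : R).
Hypotheses (x12 : x1 <= x2) (y12 : y1 <= y2).

Lemma continuous_h f (y : R) : y = y1 \/ y = y2 ->
  continuous_over (frame x1 x2 y1 y2) f ->
  continuous_itv x1 x2 (fun t => f (t +i* y)%C).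
Proof.
move=> yy fc t tx; apply: (@continuous_comp _ _ _ (fun s : R => (s +i* y)%C : C) f).
  exact: continuous_hline.
apply: fc; split; first by split => //=; case: yy => ->; rewrite lexx y12.
by case: yy => ->; [constructor 3|constructor 4].
Qed.

Lemma continuous_v f (x : R) : x = x1 \/ x = x2 ->
  continuous_over (frame x1 x2 y1 y2) f ->
  continuous_itv y1 y2 (fun t => f (x +i* t)%C).
Proof.
move=> xx fc t ty; apply: (@continuous_comp _ _ _ (fun s : R => (x +i* s)%C : C) f).
  exact: continuous_vline.
apply: fc; split; first by split => //=; case: xx => ->; rewrite lexx x12.
by case: xx => ->; [constructor 1|constructor 2].
Qed.

Lemma eq_rint f g : (forall z, frame x1 x2 y1 y2 z -> f z = g z) ->
  rint f x1 x2 y1 y2 = rint g x1 x2 y1 y2.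
Proof.
move=> fg; rewrite /rint; congr (_ + _ * _); apply: eq_cint => t txy;
  congr (_ - _); apply: fg.
- by split; [split; rewrite //= lexx|constructor 3].
- by split; [split; rewrite //= lexx andbT|constructor 4].
- by split; [split; rewrite //= lexx andbT|constructor 2].
- by split; [split; rewrite //= lexx|constructor 1].
Qed.

Lemma continuous_hB f : continuous_over (frame x1 x2 y1 y2) f ->
  continuous_itv x1 x2 (fun t => f (t +i* y1)%C - f (t +i* y2)%C).
Proof.
by move=> fc t tx; apply: cvgB; [apply: (@continuous_h f y1)|
  apply: (@continuous_h f y2)] => //; [left|right].
Qed.

Lemma continuous_vB f : continuous_over (frame x1 x2 y1 y2) f ->
  continuous_itv y1 y2 (fun t => f (x2 +i* t)%C - f (x1 +i* t)%C).
Proof.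
by move=> fc t tx; apply: cvgB; [apply: (@continuous_v f x2)|
  apply: (@continuous_v f x1)] => //; [right|left].
Qed.

Lemma rintD f g :
  continuous_over (frame x1 x2 y1 y2) f -> continuous_over (frame x1 x2 y1 y2) g ->
  rint (fun z => f z + g z) x1 x2 y1 y2 =
  rint f x1 x2 y1 y2 + rint g x1 x2 y1 y2.
Proof.
move=> fc gc; rewrite /rint addrACA -mulrDr -!cintD; last 4 first.
- exact: continuous_vB.
- exact: continuous_vB.
- exact: continuous_hB.
- exact: continuous_hB.
by congr (_ + _ * _); apply: eq_cint => t _; rewrite opprD addrACA.
Qed.

Lemma rintZ c f : continuous_over (frame x1 x2 y1 y2) f ->
  rint (fun z => c * f z) x1 x2 y1 y2 = c * rint f x1 x2 y1 y2.
Proof.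
move=> fc; have [hc vc] := (continuous_hB fc, continuous_vB fc).
rewrite /rint [RHS]mulrDr [c * ('i * _)]mulrCA.
rewrite -(cintZ c hc) -(cintZ c vc).
by congr (_ + _ * _); apply: eq_cint => t _; rewrite mulrBr.
Qed.

Lemma rint_affine c c' : rint (fun z => c * z + c') x1 x2 y1 y2 = 0.
Proof.
rewrite /rint (@eq_cint _ x1 x2 _ (fun=> c * ('i * (y1 - y2)%:C%C))); last first.
  move=> t _; rewrite opprD addrACA subrr addr0 -mulrBr; congr (_ * _).
  by apply: complex_ext => /=; ring.
rewrite (@eq_cint _ y1 y2 _ (fun=> c * (x2 - x1)%:C%C)); last first.
  move=> t _; rewrite opprD addrACA subrr addr0 -mulrBr; congr (_ * _).
  by apply: complex_ext => /=; ring.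
rewrite !cint_cst// -[(y1 - y2)]opprB rmorphN /=; ring.
Qed.

Lemma cmod_rint_le f (M : R) : continuous_over (frame x1 x2 y1 y2) f ->
  (forall z, frame x1 x2 y1 y2 z -> cmod (f z) <= M) ->
  cmod (rint f x1 x2 y1 y2) <= 4 * M * ((x2 - x1) + (y2 - y1)).
Proof.
move=> fc fM; rewrite (le_trans (ler_cmodD _ _))// cmodM cmodi mul1r mulrDr.
have -> : 4 * M = 2 * (M + M) by ring.
apply: lerD; apply: cmod_cint_le => //; [exact: continuous_hB| |
  exact: continuous_vB|] => t txy;
  rewrite (le_trans (ler_cmodD _ _))// cmodN lerD// fM//.
- by split; [split; rewrite //= lexx|constructor 3].
- by split; [split; rewrite //= lexx andbT|constructor 4].
- by split; [split; rewrite //= lexx andbT|constructor 2].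
- by split; [split; rewrite //= lexx|constructor 1].
Qed.

End Frame.

Lemma frame_sub_rect x1 x2 y1 y2 : frame x1 x2 y1 y2 `<=` rect x1 x2 y1 y2.
Proof. by move=> z []. Qed.

Lemma rint_splitx f x1 x2 x3 y1 y2 : x1 <= x2 <= x3 -> y1 <= y2 ->
  continuous_over (rect x1 x3 y1 y2) f ->
  rint f x1 x3 y1 y2 = rint f x1 x2 y1 y2 + rint f x2 x3 y1 y2.
Proof.
move=> x123 y12 fc; have /andP[x12 x23] := x123.
have x13 := le_trans x12 x23.
have fc13 : continuous_over (frame x1 x3 y1 y2) f by move=> z /frame_sub_rect /fc.
have fc12 : continuous_over (frame x1 x2 y1 y2) f.
  by move=> z [[/andP[zx1 zx2] zy] _]; apply: fc; split; rewrite // zx1 (le_trans zx2).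
have fc23 : continuous_over (frame x2 x3 y1 y2) f.
  by move=> z [[/andP[zx2 zx3] zy] _]; apply: fc; split; rewrite // zx3 (le_trans x12).
rewrite /rint (cint_split x123); last exact: continuous_hB.
rewrite addrACA -mulrDr; congr (_ + _ * _); rewrite -cintD.
- by apply: eq_cint => t _; rewrite [RHS]addrC addrA subrK.
- exact: continuous_vB.
- exact: continuous_vB.
Qed.

Lemma rint_splity f x1 x2 y1 y2 y3 : x1 <= x2 -> y1 <= y2 <= y3 ->
  continuous_over (rect x1 x2 y1 y3) f ->
  rint f x1 x2 y1 y3 = rint f x1 x2 y1 y2 + rint f x1 x2 y2 y3.
Proof.
move=> x12 y123 fc; have /andP[y12 y23] := y123.
have y13 := le_trans y12 y23.
have fc13 : continuous_over (frame x1 x2 y1 y3) f by move=> z /frame_sub_rect /fc.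
have fc12 : continuous_over (frame x1 x2 y1 y2) f.
  by move=> z [[zx /andP[zy1 zy2]] _]; apply: fc; split; rewrite // zy1 (le_trans zy2).
have fc23 : continuous_over (frame x1 x2 y2 y3) f.
  by move=> z [[zx /andP[zy2 zy3]] _]; apply: fc; split; rewrite // zy3 (le_trans y12).
rewrite /rint (cint_split y123); last exact: continuous_vB.
rewrite mulrDr addrACA; congr (_ + _); rewrite -cintD.
- by apply: eq_cint => t _; rewrite addrA subrK.
- exact: continuous_hB.
- exact: continuous_hB.
Qed.

End RectangleIntegral.

Arguments rint : simpl never.

(** * Bisection of rectangles and Goursat's theorem *)

Section Bisection.
Context {R : realType}.
Implicit Types (x y d : R).

Lemma nested_point (u v : nat -> R) :
  (forall n, [/\ u n <= u n.+1, u n <= v n & v n.+1 <= v n]) ->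
  exists x, forall n, u n <= x <= v n.
Proof.
move=> uv; have uS : {homo u : m n / (m <= n)%N >-> m <= n}.
  by apply: homo_leq => [|? ? ? /le_trans|n] //; [exact|case: (uv n)].
have vS : {homo v : m n / (m <= n)%N >-> n <= m}.
  by apply: homo_leq => [|b a c ab bc|n] //; [exact: le_trans bc ab|case: (uv n)].
have ub n : ubound (range u) (v n).
  move=> _ [m _ <-]; have [_ umv _] := uv (maxn m n).
  rewrite (le_trans (uS _ _ (leq_maxl m n)))// (le_trans umv)//.
  exact: vS (leq_maxr m n).
exists (sup (range u)) => n; apply/andP; split.
  by apply: ub_le_sup; [exists (v n); exact: ub|exists n].
by apply: ge_sup; [exists (u n); exists n|exact: ub].
Qed.

Lemma halving_small (s d : R) : 0 < d -> exists n, s / 2 ^+ n < d.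
Proof.
move=> d0; exists (Num.truncn (s / d)).+1; set n := _.+1.
rewrite ltr_pdivrMr ?exprn_gt0// mulrC -ltr_pdivrMr//.
rewrite (lt_trans (truncnS_gt _))// -natrX ltr_nat; exact: ltn_expl.
Qed.

Definition is_half (p q : R * R) :=
  q = (p.1, (p.1 + p.2) / 2) \/ q = ((p.1 + p.2) / 2, p.2).

Lemma is_half_sub p q : p.1 <= p.2 -> is_half p q ->
  [/\ p.1 <= q.1, q.1 <= q.2, q.2 <= p.2 & q.2 - q.1 = (p.2 - p.1) / 2].
Proof. by case: p => a b /= ab [->|->] /=; split; lra. Qed.

(** A rectangle for which P fails has a quarter for which P fails; iterating,
    such rectangles shrink to a point, around which P is known to hold. *)
Lemma rect_induction (P : R * R -> R * R -> Prop) :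
  (forall p q, p.1 <= p.2 -> q.1 <= q.2 ->
    (forall p' q', is_half p p' -> is_half q q' -> P p' q') -> P p q) ->
  forall p q, p.1 <= p.2 -> q.1 <= q.2 ->
  (forall x y, p.1 <= x <= p.2 -> q.1 <= y <= q.2 ->
    exists2 d, 0 < d & forall p' q', p'.1 <= x <= p'.2 -> q'.1 <= y <= q'.2 ->
      p'.2 - p'.1 < d -> q'.2 - q'.1 < d -> P p' q') ->
  P p q.
Proof.
move=> Phalf p q p12 q12 Ploc; apply: contrapT => nP.
pose bad (r : (R * R) * (R * R)) :=
  [/\ r.1.1 <= r.1.2, r.2.1 <= r.2.2 & ~ P r.1 r.2].
have /choice[next nextP] : forall r, exists r', bad r ->
    [/\ bad r', is_half r.1 r'.1 & is_half r.2 r'.2].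
  move=> [p' q']; have [[/= p'12 q'12 nP']|nb] := pselect (bad (p', q')); last first.
    by exists (p', q').
  apply: contrapT => noquarter; apply: nP'; apply: Phalf => // p'' q'' hp hq.
  apply: contrapT => nP''; apply: noquarter; exists (p'', q'') => _; split => //.
  by split => //=; [have [] := is_half_sub p'12 hp|have [] := is_half_sub q'12 hq].
pose r n := iter n next (p, q).
have badr n : bad (r n) by elim: n => [|n /nextP[]].
have hp n : is_half (r n).1 (r n.+1).1 by have [] := nextP _ (badr n).
have hq n : is_half (r n).2 (r n.+1).2 by have [] := nextP _ (badr n).
have le1 n : (r n).1.1 <= (r n).1.2 by have [] := badr n.
have le2 n : (r n).2.1 <= (r n).2.2 by have [] := badr n.
have [x xP] : exists x, forall n, (r n).1.1 <= x <= (r n).1.2.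
  apply: (@nested_point (fun n => (r n).1.1) (fun n => (r n).1.2)) => n.
  by split => //; have [] := is_half_sub (le1 n) (hp n).
have [y yP] : exists y, forall n, (r n).2.1 <= y <= (r n).2.2.
  apply: (@nested_point (fun n => (r n).2.1) (fun n => (r n).2.2)) => n.
  by split => //; have [] := is_half_sub (le2 n) (hq n).
have size1 n : (r n).1.2 - (r n).1.1 = (p.2 - p.1) / 2 ^+ n.
  elim: n => [|n IH]; first by rewrite expr0 divr1.
  have [_ _ _ ->] := is_half_sub (le1 n) (hp n).
  by rewrite IH exprSr invfM mulrA.
have size2 n : (r n).2.2 - (r n).2.1 = (q.2 - q.1) / 2 ^+ n.
  elim: n => [|n IH]; first by rewrite expr0 divr1.
  have [_ _ _ ->] := is_half_sub (le2 n) (hq n).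
  by rewrite IH exprSr invfM mulrA.
have [d d0 Pd] := Ploc x y (xP 0%N) (yP 0%N).
have [n nd] := halving_small ((p.2 - p.1) + (q.2 - q.1)) d0.
have [_ _ []] := badr n; apply: Pd => //.
  rewrite size1 (le_lt_trans _ nd)// ler_wpM2r ?invr_ge0 ?exprn_ge0//; lra.
rewrite size2 (le_lt_trans _ nd)// ler_wpM2r ?invr_ge0 ?exprn_ge0//; lra.
Qed.

End Bisection.

Section Goursat.
Context {R : realType}.
Local Notation C := (Cplx R).
Implicit Types (f g : C -> C) (x y : R).

Lemma derivable_continuous f (z : C) : derivable f z 1 -> {for z, continuous f}.
Proof. by move/derivable1_diffP/differentiable_continuous. Qed.

Lemma small_eq0 (s t : R) : 0 <= s -> 0 <= t ->
  (forall e : R, 0 < e -> s <= e * t) -> s = 0.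
Proof.
move=> s0 t0 st; apply/eqP; rewrite eq_le s0 andbT; apply/ler_addgt0Pl => e e0.
rewrite addr0; have t1 : 0 < t + 1 by lra.
rewrite (le_trans (st _ (divr_gt0 e0 t1)))// mulrAC ler_pdivrMr//; nra.
Qed.

(** On a small rectangle the function is affine up to an error that is small
    with respect to the diameter, and affine functions integrate to 0: the
    integral is thus o(diameter^2), a bound that bisection propagates. *)
Theorem goursat f x1 x2 y1 y2 : x1 <= x2 -> y1 <= y2 ->
  (forall z, rect x1 x2 y1 y2 z -> derivable f z 1) ->
  rint f x1 x2 y1 y2 = 0.
Proof.
move=> x12 y12 fd.
have fc : continuous_over (rect x1 x2 y1 y2) f.
  by move=> z /fd; exact: derivable_continuous.
apply/eqP; rewrite -[_ == 0]negbK -cmod_gt0 -leNgt.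
suff : forall e : R, 0 < e ->
    cmod (rint f x1 x2 y1 y2) <= e * ((x2 - x1) + (y2 - y1)) ^+ 2.
  by move=> /small_eq0 ->; rewrite ?cmod_ge0 ?sqr_ge0.
move=> e e0.
pose P (p q : R * R) := x1 <= p.1 -> p.2 <= x2 -> y1 <= q.1 -> q.2 <= y2 ->
  cmod (rint f p.1 p.2 q.1 q.2) <= e * ((p.2 - p.1) + (q.2 - q.1)) ^+ 2.
suff : P (x1, x2) (y1, y2) by apply => /=.
apply: rect_induction => //.
- move=> [a c] [b d] /= ac bd Pq; rewrite /P /= => x1a cx2 y1b dy2.
  have Pq' p q : is_half (a, c) p -> is_half (b, d) q ->
      cmod (rint f p.1 p.2 q.1 q.2) <= e * (((c - a) + (d - b)) / 2) ^+ 2.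
    move=> hp hq; have [/= ap _ pc sp] := is_half_sub (p := (a, c)) ac hp.
    have [/= bq _ qd sq] := is_half_sub (p := (b, d)) bd hq.
    have -> : (c - a + (d - b)) / 2 = p.2 - p.1 + (q.2 - q.1).
      by rewrite sp sq; field.
    by apply: Pq => //; lra.
  have fc' : continuous_over (rect a c b d) f.
    by move=> z [zx zy]; apply: fc; split; lra.
  pose m := (a + c) / 2; pose k := (b + d) / 2.
  have [am bk] : a <= m <= c /\ b <= k <= d by rewrite /m /k; split; lra.
  have [/andP[am1 mc] /andP[bk1 kd]] := (am, bk).
  have fl : continuous_over (rect a m b d) f.
    by move=> z [/andP[za zm] zy]; apply: fc'; rewrite /rect /= za (le_trans zm).
  have fr : continuous_over (rect m c b d) f.
    by move=> z [/andP[za zm] zy]; apply: fc'; rewrite /rect /= zm (le_trans am1).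
  rewrite (rint_splitx am bd fc') (rint_splity am1 bk fl) (rint_splity mc bk fr).
  have Q1 := Pq' (a, m) (b, k) (or_introl erefl) (or_introl erefl).
  have Q2 := Pq' (a, m) (k, d) (or_introl erefl) (or_intror erefl).
  have Q3 := Pq' (m, c) (b, k) (or_intror erefl) (or_introl erefl).
  have Q4 := Pq' (m, c) (k, d) (or_intror erefl) (or_intror erefl).
  rewrite (le_trans (ler_cmodD _ _))//.
  have D1 := ler_cmodD (rint f a m b k) (rint f a m k d).
  have D2 := ler_cmodD (rint f m c b k) (rint f m c k d).
  move: Q1 Q2 Q3 Q4 D1 D2 => /=; rewrite expr_div_n; lra.
- move=> x y /= xx yy.
  have /derivableP/is_derive_cmodP fxy : derivable f (x +i* y)%C 1 by exact: fd.
  have [d d0 fxyd] := fxy (e / 4) (divr_gt0 e0 (ltr0Sn _ 3)).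
  set z0 : C := (x +i* y)%C in fxyd *; set l := derive _ _ _ in fxyd.
  (* Both sides below d / 2 keep the rectangle in the disc of radius d. *)
  exists (d / 2); first by rewrite divr_gt0.
  move=> [a c] [b k] /= ax bk sx sy; rewrite /P /= => x1a cx2 y1b ky2.
  have ac : a <= c by lra.
  have bk' : b <= k by lra.
  have fc' : continuous_over (frame a c b k) f.
    by move=> z [[zx zy] _]; apply: fc; split; lra.
  pose s := (c - a) + (k - b).
  pose aff (z : C) := l * z + (f z0 - l * z0).
  pose rho (z : C) := f z - aff z.
  have affc : continuous_over (frame a c b k) aff.
    move=> z _; apply: continuousD; first exact: mulrl_continuous.
    exact: cst_continuous.
  have rhoc : continuous_over (frame a c b k) rho.
    by move=> z zf; apply: continuousB; [exact: fc'|exact: affc].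
  have -> : rint f a c b k = rint rho a c b k.
    rewrite -[RHS]addr0 -(rint_affine ac bk' l (f z0 - l * z0)).
    rewrite -(rintD ac bk' rhoc affc).
    by apply: (eq_rint ac bk') => z _; rewrite /rho /aff subrK.
  have rho_le z : frame a c b k z -> cmod (rho z) <= e / 4 * s.
    move=> [[zx zy] _]; have zs : cmod (z - z0) <= s.
      rewrite (le_trans (cmod_le_ReIm _))// !raddfB /= /s.
      by apply: lerD; rewrite ler_norml; lra.
    have zd : cmod (z - z0) < d by apply: (le_lt_trans zs); rewrite /s; lra.
    have := fxyd _ zd; rewrite (addrC z0) subrK.
    have -> : f z - f z0 - l * (z - z0) = rho z by rewrite /rho /aff; ring.
    by move=> /le_trans -> //; rewrite ler_wpM2l// divr_ge0// ltW.
  rewrite (le_trans (cmod_rint_le ac bk' rhoc rho_le))// -/s; nra.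
Qed.

End Goursat.

(** * Cauchy's formula and Cauchy transforms *)

Section CauchyFormula.
Context {R : realType}.
Local Notation C := (Cplx R).
Implicit Types (f phi k : C -> C) (a z : C) (x y : R).

Lemma continuous_cmodP f a : {for a, continuous f} <->
  forall e : R, 0 < e -> exists2 d : R, 0 < d &
    forall z, cmod (z - a) < d -> cmod (f z - f a) < e.
Proof.
split=> [fa e e0|fa].
  by have /(cvg_cmodP (F := nbhs a))/(_ e e0)/nbhs_cmodP := fa.
by apply/(cvg_cmodP (F := nbhs a)) => e e0; exact/nbhs_cmodP/fa.
Qed.

Lemma derivable_inv_sub a z : z != a ->
  derivable (fun u : C => (u - a)^-1) z 1.
Proof.
move=> za; have d : derivable (id - cst a) z 1.
  exact: derivableB (@derivable_id _ C _ _) (derivable_cst _ _ _).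
by apply: derivableV d; rewrite /= subr_eq0.
Qed.

Lemma quotient_derivable f a z : z != a -> derivable f z 1 ->
  derivable (fun u => (f u - f a) / (u - a)) z 1.
Proof.
move=> za fz.
have d : derivable (f - cst (f a)) z 1 by exact: derivableB fz (derivable_cst _ _ _).
exact: derivableM d (derivable_inv_sub za).
Qed.

Definition slope f a l z : C := if z == a then l else (f z - f a) / (z - a).

Lemma slope_derivable f a l z : z != a -> derivable f z 1 ->
  derivable (slope f a l) z 1.
Proof.
move=> za fz; apply: near_eq_derivable (quotient_derivable za fz).
have za0 : 0 < cmod (z - a) by rewrite cmod_gt0 subr_eq0.
apply/nbhs_cmodP; exists (cmod (z - a)) => // u uz.
rewrite /slope; case: eqP => // ua.
by move: uz; rewrite ua cmodB ltxx.
Qed.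

Lemma slope_near f a l : is_derive a 1 f l -> forall e : R, 0 < e ->
  exists2 d : R, 0 < d & forall z, cmod (z - a) < d -> cmod (slope f a l z - l) <= e.
Proof.
move=> /is_derive_cmodP fl e e0; have [d d0 fd] := fl e e0.
exists d => // z zd; rewrite /slope; case: eqVneq => [_|za].
  by rewrite subrr cmod0 ltW.
have za0 : 0 < cmod (z - a) by rewrite cmod_gt0 subr_eq0.
rewrite -(ler_pM2r za0) -cmodM mulrBl divfK ?subr_eq0//.
by have := fd _ zd; rewrite (addrC a) subrK.
Qed.

Lemma slope_continuous f a l : is_derive a 1 f l ->
  {for a, continuous (slope f a l)}.
Proof.
move=> fl; apply/continuous_cmodP => e e0.
have [d d0 fd] := slope_near fl (divr_gt0 e0 (ltr0Sn R 1)).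
exists d => // z zd.
rewrite [slope f a l a]/slope eqxx (le_lt_trans (fd _ zd))//; lra.
Qed.

Lemma pos_lower_bound (s t : R) : 0 < s -> 0 < t ->
  exists r : R, [/\ 0 < r, r <= s & r <= t].
Proof.
move=> s0 t0; have [st|/ltW ts] := leP s t; first by exists s.
by exists t.
Qed.

(** By Goursat's theorem the rectangle can be shrunk around a, the only point
    where the difference quotient may fail to be differentiable; it is bounded
    there, so that the integral tends to 0 with the perimeter. *)
Lemma rint_slope f a l x1 x2 y1 y2 :
  x1 < complex.Re a < x2 -> y1 < complex.Im a < y2 ->
  (forall z, rect x1 x2 y1 y2 z -> derivable f z 1) -> is_derive a 1 f l ->
  rint (slope f a l) x1 x2 y1 y2 = 0.
Proof.
move=> /andP[x1a ax2] /andP[y1a ay2] fd fl; set h := slope f a l.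
set p := complex.Re a in x1a ax2 *; set q := complex.Im a in y1a ay2 *.
have hd z : rect x1 x2 y1 y2 z -> z != a -> derivable h z 1.
  by move=> zr za; apply: slope_derivable => //; exact: fd.
have hc : continuous_over (rect x1 x2 y1 y2) h.
  move=> z zr; have [->|za] := eqVneq z a; first exact: slope_continuous.
  exact/derivable_continuous/hd.
have [d d0 hM] := slope_near fl ltr01.
pose M := cmod l + 1.
have M0 : 0 <= M by rewrite addr_ge0 ?cmod_ge0.
apply/eqP; rewrite -[_ == 0]negbK -cmod_gt0 -leNgt.
suff H e : 0 < e -> cmod (rint h x1 x2 y1 y2) <= e * (16 * M).
  by rewrite (small_eq0 (cmod_ge0 _) _ H)// mulr_ge0.
move=> e0.
(* r is half the side of the shrunk square: it must fit in the rectangle and in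
   the disc where the slope is bounded by M, and be at most e. *)
have [ra [ra0 ra1 ra2]] := pos_lower_bound
  (ltac:(lra) : 0 < p - x1) (ltac:(lra) : 0 < x2 - p).
have [rb [rb0 rb1 rb2]] := pos_lower_bound
  (ltac:(lra) : 0 < q - y1) (ltac:(lra) : 0 < y2 - q).
have [rc [rc0 rc1 rc2]] := pos_lower_bound ra0 rb0.
have [rd [rd0 rd1 rd2]] := pos_lower_bound (ltac:(lra) : 0 < d / 3) e0.
have [r [r0 r1 r2]] := pos_lower_bound rc0 rd0.
have rx1 : x1 <= p - r by lra.
have rx2 : p + r <= x2 by lra.
have ry1 : y1 <= q - r by lra.
have ry2 : q + r <= y2 by lra.
have rsmall : 2 * r < d by lra.
have re : r <= e by lra.
clear ra ra0 ra1 ra2 rb rb0 rb1 rb2 rc rc0 rc1 rc2 rd rd0 rd1 rd2 r1 r2.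
have wr : continuous_over (rect (p - r) x2 y1 y2) h.
  by move=> z [zx zy]; apply: hc; split => //; lra.
have mr : continuous_over (rect (p - r) (p + r) y1 y2) h.
  by move=> z [zx zy]; apply: hc; split => //; lra.
have ur : continuous_over (rect (p - r) (p + r) (q - r) y2) h.
  by move=> z [zx zy]; apply: hc; split => //; lra.
have y12 : y1 <= y2 by lra.
have pr : p - r <= p + r by lra.
have qr : q - r <= q + r by lra.
have away z : complex.Re z != p \/ complex.Im z != q -> z != a.
  by move=> zpq; apply/eqP => za; case: zpq; rewrite za eqxx.
have G1 : rint h x1 (p - r) y1 y2 = 0.
  apply: goursat => // z [zx zy]; apply: hd; first by split => //; lra.
  by apply: away; left; rewrite lt_eqF//; lra.
have G2 : rint h (p + r) x2 y1 y2 = 0.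
  apply: goursat => // z [zx zy]; apply: hd; first by split => //; lra.
  by apply: away; left; rewrite gt_eqF//; lra.
have G3 : rint h (p - r) (p + r) y1 (q - r) = 0.
  apply: goursat => // z [zx zy]; apply: hd; first by split => //; lra.
  by apply: away; right; rewrite lt_eqF//; lra.
have G4 : rint h (p - r) (p + r) (q + r) y2 = 0.
  apply: goursat => // z [zx zy]; apply: hd; first by split => //; lra.
  by apply: away; right; rewrite gt_eqF//; lra.
have x123 : x1 <= p - r <= x2 by lra.
have x234 : p - r <= p + r <= x2 by lra.
have y123 : y1 <= q - r <= y2 by lra.
have y234 : q - r <= q + r <= y2 by lra.
rewrite (rint_splitx x123 y12 hc) G1 add0r (rint_splitx x234 y12 wr) G2 addr0.
rewrite (rint_splity pr y123 mr) G3 add0r (rint_splity pr y234 ur) G4 addr0.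
have sc : continuous_over (frame (p - r) (p + r) (q - r) (q + r)) h.
  by move=> z [[zx zy] _]; apply: ur; split => //; lra.
have sM z : frame (p - r) (p + r) (q - r) (q + r) z -> cmod (h z) <= M.
  move=> [[zx zy] _]; rewrite -[h z](subrK l) (le_trans (ler_cmodD _ _))//.
  rewrite addrC lerD2l hM// (le_lt_trans (cmod_le_ReIm _))// !raddfB /= -/p -/q.
  by apply: le_lt_trans rsmall; rewrite mulr_natl mulr2n lerD// ler_norml; lra.
rewrite (le_trans (cmod_rint_le pr qr sc sM))//; nra.
Qed.

Lemma continuous_kernel phi a z : {for z, continuous phi} -> z != a ->
  {for z, continuous (fun u => phi u * (u - a)^-1)}.
Proof.
move=> fz za.
exact: (continuousM fz (derivable_continuous (derivable_inv_sub za))).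
Qed.

(** Cauchy's formula. Instead of evaluating the integral of 1 / (z - a), it is
    enough for a smoothness result that it is itself a smooth function of a and
    does not vanish. *)
Lemma cauchy_rint f a x1 x2 y1 y2 :
  x1 < complex.Re a < x2 -> y1 < complex.Im a < y2 ->
  (forall z, rect x1 x2 y1 y2 z -> derivable f z 1) ->
  rint (fun z => f z * (z - a)^-1) x1 x2 y1 y2 =
  f a * rint (fun z => (z - a)^-1) x1 x2 y1 y2.
Proof.
move=> xa ya fd.
have ar : rect x1 x2 y1 y2 a by split; lra.
have x12 : x1 <= x2 by lra.
have y12 : y1 <= y2 by lra.
have fa z : frame x1 x2 y1 y2 z -> z != a.
  move=> [_ zf]; apply/eqP => za; move: zf xa ya; rewrite za.
  by case=> ->; rewrite ltxx ?andbF.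
have fc : continuous_over (frame x1 x2 y1 y2) (fun z => f z * (z - a)^-1).
  move=> z zf; apply: continuous_kernel (fa z zf).
  by apply/derivable_continuous/fd; case: zf.
have kc : continuous_over (frame x1 x2 y1 y2) (fun z => (z - a)^-1).
  by move=> z zf; exact: derivable_continuous (derivable_inv_sub (fa z zf)).
have kc' : continuous_over (frame x1 x2 y1 y2) (fun z => - f a * (z - a)^-1).
  by move=> z zf; exact: (continuousM (@cst_continuous C C _ z) (kc z zf)).
have /derivableP fl := fd a ar.
have := rint_slope xa ya fd fl.
rewrite (eq_rint (g := fun z => f z * (z - a)^-1 + - f a * (z - a)^-1) x12 y12).
  rewrite (rintD x12 y12 fc kc') (rintZ x12 y12 (- f a) kc) mulNr.
  by move/eqP; rewrite subr_eq0 => /eqP.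
by move=> z zf; rewrite /slope (negbTE (fa z zf)) -mulrDl.
Qed.

Lemma Re_cint_ge (b e M : R) (phi : R -> C) : b <= e -> continuous_itv b e phi ->
  (forall t, b <= t <= e -> M <= complex.Re (phi t)) ->
  M * (e - b) <= complex.Re (cint b e phi).
Proof.
move=> be phic phiM.
have -> : M * (e - b) = complex.Re (cint b e (fun=> M%:C%C)).
  by rewrite cint_cst//= mul0r subr0 mulrC.
rewrite /cint /=; apply: le_Rintegral => //.
- by apply: integrable_continuous => t _; exact: cst_continuous.
- exact: integrable_Re.
Qed.

Lemma continuous_real_complex (u : R -> R) (t : R) : {for t, continuous u} ->
  {for t, continuous (fun x => (u x)%:C%C : C)}.
Proof.
move=> /cvgrPdist_lt uc; apply/cvg_cmodP => e e0.
by apply: filterS (uc e e0) => x; rewrite -rmorphB cmod_real distrC.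
Qed.

(** At the centre of a square the real kernel K has a positive integral, and
    the sum of the contributions of the four sides is 'i times such integrals. *)
Lemma rint_winding_neq0 (x0 y0 s : R) : 0 < s ->
  rint (fun z => (z - (x0 +i* y0)%C)^-1) (x0 - s) (x0 + s) (y0 - s) (y0 + s) != 0.
Proof.
move=> s0; pose a : C := (x0 +i* y0)%C.
have den_gt0 (u : R) : 0 < u ^+ 2 + s ^+ 2.
  by rewrite ltr_wpDl ?sqr_ge0// exprn_gt0.
have den_neq0 (u : R) : u ^+ 2 + s ^+ 2 != 0 by rewrite gt_eqF.
pose K (c t : R) : C := (2 * s / ((t - c) ^+ 2 + s ^+ 2))%:C%C.
have Kc c b e : continuous_itv b e (K c).
  move=> t _; apply: continuous_real_complex.
  have dB : x - c @[x --> t] --> t - c by apply: cvgB; [exact: cvg_id|exact: cvg_cst].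
  have d : (x - c) ^+ 2 + s ^+ 2 @[x --> t] --> (t - c) ^+ 2 + s ^+ 2.
    by apply: cvgD; [exact: (cvgM dB dB)|exact: cvg_cst].
  have dV : ((x - c) ^+ 2 + s ^+ 2)^-1 @[x --> t] --> ((t - c) ^+ 2 + s ^+ 2)^-1.
    exact: cvgV.
  have dM : 2 * s / ((x - c) ^+ 2 + s ^+ 2) @[x --> t] -->
      2 * s / ((t - c) ^+ 2 + s ^+ 2) by exact: cvgMl_tmp.
  exact: dM.
have KRe c : 2 <= complex.Re (cint (c - s) (c + s) (K c)).
  have -> : 2 = s^-1 * ((c + s) - (c - s)) by field; rewrite gt_eqF.
  apply: Re_cint_ge => [|//|t tc]; first by lra.
  rewrite /K /= ler_pdivlMr// -(ler_pM2l s0) mulrA mulfV ?gt_eqF// mul1r; nra.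
rewrite -/a; suff -> : rint (fun z => (z - a)^-1) (x0 - s) (x0 + s) (y0 - s) (y0 + s) =
    'i * (cint (x0 - s) (x0 + s) (K x0) + cint (y0 - s) (y0 + s) (K y0)).
  apply/eqP => /(congr1 (@complex.Im R)).
  have := KRe x0; have := KRe y0.
  case: (cint _ _ _) => u v; case: (cint _ _ _) => u' v' /=; lra.
rewrite mulrDr /rint; congr (_ + _ * _).
  rewrite -(cintZ 'i (Kc _ _ _)); apply: eq_cint => t _; rewrite /K.
  rewrite (_ : (t +i* (y0 - s))%C - a = ((t - x0) +i* (- s))%C); last first.
    by apply: complex_ext; rewrite raddfB /=; ring.
  rewrite (_ : (t +i* (y0 + s))%C - a = ((t - x0) +i* s)%C); last first.
    by apply: complex_ext; rewrite raddfB /=; ring.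
  by have D := den_neq0 (t - x0); apply: complex_ext; rewrite raddfB /= sqrrN; field.
apply: eq_cint => t _; rewrite /K.
rewrite (_ : ((x0 + s) +i* t)%C - a = (s +i* (t - y0))%C); last first.
  by apply: complex_ext; rewrite raddfB /=; ring.
rewrite (_ : ((x0 - s) +i* t)%C - a = ((- s) +i* (t - y0))%C); last first.
  by apply: complex_ext; rewrite raddfB /=; ring.
have D := den_neq0 (t - y0); have D' := D; rewrite addrC in D'.
by apply: complex_ext; rewrite raddfB /= sqrrN; field; rewrite ?D ?D'.
Qed.

(** Differentiation under the integral sign: the remainder of the kernel is
    quadratic in h uniformly along the frame, hence so is its integral. *)
Lemma cauchy_transform_is_derive phi k k1 a (B M r : R) x1 x2 y1 y2 :
  x1 <= x2 -> y1 <= y2 -> 0 < r -> 0 <= B -> 0 <= M ->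
  (forall z, frame x1 x2 y1 y2 z -> 2 * r <= cmod (z - a)) ->
  (forall z, frame x1 x2 y1 y2 z -> cmod (phi z) <= B) ->
  continuous_over (frame x1 x2 y1 y2) phi ->
  (forall b, cmod (b - a) < r ->
     continuous_over (frame x1 x2 y1 y2) (fun z => k (z - b))) ->
  continuous_over (frame x1 x2 y1 y2) (fun z => k1 (z - a)) ->
  (forall s h : C, 2 * r <= cmod s -> cmod h < r ->
     cmod (k (s - h) - k s - h * k1 s) <= M * cmod h ^+ 2) ->
  is_derive a 1 (fun b => rint (fun z => phi z * k (z - b)) x1 x2 y1 y2)
    (rint (fun z => phi z * k1 (z - a)) x1 x2 y1 y2).
Proof.
move=> x12 y12 r0 B0 M0 far phiB phic kc k1c kM.
have pc b : cmod (b - a) < r ->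
    continuous_over (frame x1 x2 y1 y2) (fun z => phi z * k (z - b)).
  by move=> ba z zf; exact: (continuousM (phic z zf) (kc b ba z zf)).
have p1c : continuous_over (frame x1 x2 y1 y2) (fun z => phi z * k1 (z - a)).
  by move=> z zf; exact: (continuousM (phic z zf) (k1c z zf)).
apply/is_derive_cmodP => e e0.
pose S := (x2 - x1) + (y2 - y1).
have S0 : 0 <= S by rewrite /S; lra.
pose N := 4 * (B * M) * S.
have N0 : 0 <= N by rewrite /N !mulr_ge0.
have [d [d0 dr de]] := pos_lower_bound r0
  (divr_gt0 e0 (ltr_wpDl N0 ltr01 : 0 < N + 1)).
exists d => // h hd.
have hr : cmod (a + h - a) < r by rewrite addrAC subrr add0r (lt_le_trans hd).
have ar : cmod (a - a) < r by rewrite subrr cmod0.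
have c1 : continuous_over (frame x1 x2 y1 y2) (fun z => - 1 * (phi z * k (z - a))).
  by move=> z zf; exact: (continuousM (@cst_continuous C C _ z) (pc a ar z zf)).
have c2 : continuous_over (frame x1 x2 y1 y2) (fun z => - h * (phi z * k1 (z - a))).
  by move=> z zf; exact: (continuousM (@cst_continuous C C _ z) (p1c z zf)).
have c3 : continuous_over (frame x1 x2 y1 y2)
    (fun z => phi z * k (z - (a + h)) + - 1 * (phi z * k (z - a))).
  by move=> z zf; exact: (continuousD (pc _ hr z zf) (c1 z zf)).
have c4 : continuous_over (frame x1 x2 y1 y2)
    (fun z => phi z * k (z - (a + h)) + - 1 * (phi z * k (z - a)) +
              - h * (phi z * k1 (z - a))).
  by move=> z zf; exact: (continuousD (c3 z zf) (c2 z zf)).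
rewrite [X in X - _](_ : _ = rint (fun z => phi z * k (z - (a + h)) +
    - 1 * (phi z * k (z - a))) x1 x2 y1 y2); last first.
  by rewrite (rintD x12 y12 (pc _ hr) c1) (rintZ x12 y12 (-1) (pc a ar)) mulN1r.
rewrite mulrC -mulNr -(rintZ x12 y12 (- h) p1c) -(rintD x12 y12 c3 c2).
have bound z : frame x1 x2 y1 y2 z -> cmod (phi z * k (z - (a + h)) +
    - 1 * (phi z * k (z - a)) + - h * (phi z * k1 (z - a))) <=
    B * M * cmod h ^+ 2.
  move=> zf.
  rewrite (_ : _ + _ = phi z * (k ((z - a) - h) - k (z - a) - h * k1 (z - a))).
    rewrite cmodM -mulrA; apply: ler_pM; rewrite ?cmod_ge0 ?phiB// kM ?far//.
    exact: lt_le_trans dr.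
  by rewrite opprD (addrA z); ring.
rewrite (le_trans (cmod_rint_le x12 y12 c4 bound))// -/S.
have -> : 4 * (B * M * cmod h ^+ 2) * S = N * cmod h * cmod h by rewrite /N; ring.
apply: ler_wpM2r; first exact: cmod_ge0.
have : N * cmod h <= N * (e / (N + 1)).
  by rewrite ler_wpM2l// ltW// (lt_le_trans hd).
move=> /le_trans -> //; rewrite mulrA ler_pdivrMr; nra.
Qed.

End CauchyFormula.

(** * Derivatives of holomorphic functions are holomorphic *)

Section DerivativeHolomorphic.
Context {R : realType}.
Local Notation C := (Cplx R).
Implicit Types (f phi : C -> C) (a b z s h : C) (r : R).

Lemma cmodV_le r s : 0 < r -> r <= cmod s -> cmod s^-1 <= r^-1.
Proof.
by move=> r0 rs; rewrite cmodV lef_pV2// posrE (lt_le_trans r0).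
Qed.

Lemma far_neq0 r s : 0 < r -> r <= cmod s -> s != 0.
Proof. by move=> r0 rs; rewrite -cmod_gt0 (lt_le_trans r0). Qed.

Lemma far_sub r s h : 2 * r <= cmod s -> cmod h < r -> r <= cmod (s - h).
Proof.
move=> rs hr; have := ler_cmodD (s - h) h; rewrite subrK; lra.
Qed.

Lemma inv_taylor r s h : 0 < r -> 2 * r <= cmod s -> cmod h < r ->
  cmod ((s - h)^-1 - s^-1 - h * s^-1 ^+ 2) <= r^-1 ^+ 3 * cmod h ^+ 2.
Proof.
move=> r0 rs hr; have rsh := far_sub rs hr.
have rs' : r <= cmod s by lra.
have [s0 sh0] := (far_neq0 r0 rs', far_neq0 r0 rsh).
have -> : (s - h)^-1 - s^-1 - h * s^-1 ^+ 2 = s^-1 ^+ 2 * (s - h)^-1 * h ^+ 2.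
  by field; rewrite s0 sh0.
rewrite cmodM (cmodX h) ler_wpM2r ?sqr_ge0// cmodM cmodX (exprSr r^-1 2).
have [A B] := (cmodV_le r0 rs', cmodV_le r0 rsh).
have r1 : 0 <= r^-1 by rewrite invr_ge0 ltW.
apply: ler_pM; rewrite ?cmod_ge0 ?exprn_ge0 ?cmod_ge0//.
by rewrite lerXn2r ?nnegrE ?cmod_ge0.
Qed.

Lemma inv2_taylor r s h : 0 < r -> 2 * r <= cmod s -> cmod h < r ->
  cmod ((s - h)^-1 ^+ 2 - s^-1 ^+ 2 - h * (2 * s^-1 ^+ 3)) <=
  3 * r^-1 ^+ 4 * cmod h ^+ 2.
Proof.
move=> r0 rs hr; have rsh := far_sub rs hr.
have rs' : r <= cmod s by lra.
have [s0 sh0] := (far_neq0 r0 rs', far_neq0 r0 rsh).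
have -> : (s - h)^-1 ^+ 2 - s^-1 ^+ 2 - h * (2 * s^-1 ^+ 3) =
    (s^-1 ^+ 2 * (s - h)^-1 ^+ 2 +
     (s^-1 ^+ 3 * (s - h)^-1 + s^-1 ^+ 3 * (s - h)^-1)) * h ^+ 2.
  by field; rewrite s0 sh0.
rewrite cmodM (cmodX h) ler_wpM2r ?sqr_ge0//.
have [A B] := (cmodV_le r0 rs', cmodV_le r0 rsh).
have r1 : 0 <= r^-1 by rewrite invr_ge0 ltW.
have P22 : cmod (s^-1 ^+ 2 * (s - h)^-1 ^+ 2) <= r^-1 ^+ 4.
  rewrite cmodM !cmodX (exprD r^-1 2 2).
  by apply: ler_pM; rewrite ?exprn_ge0 ?cmod_ge0// lerXn2r ?nnegrE ?cmod_ge0.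
have P31 : cmod (s^-1 ^+ 3 * (s - h)^-1) <= r^-1 ^+ 4.
  rewrite cmodM cmodX (exprSr r^-1 3).
  apply: ler_pM; rewrite ?exprn_ge0 ?cmod_ge0//.
  by rewrite lerXn2r ?nnegrE ?cmod_ge0.
have D1 := ler_cmodD (s^-1 ^+ 2 * (s - h)^-1 ^+ 2)
  (s^-1 ^+ 3 * (s - h)^-1 + s^-1 ^+ 3 * (s - h)^-1).
have D2 := ler_cmodD (s^-1 ^+ 3 * (s - h)^-1) (s^-1 ^+ 3 * (s - h)^-1).
by rewrite (le_trans D1)//; lra.
Qed.

Section Transform.
Variables (x0 y0 w : R).
Hypothesis w0 : 0 < w.

Local Notation a0 := ((x0 +i* y0)%C : C).
Local Notation square := (rect (x0 - w) (x0 + w) (y0 - w) (y0 + w)).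
Local Notation edge := (frame (x0 - w) (x0 + w) (y0 - w) (y0 + w)).
Local Notation edge_int f := (rint f (x0 - w) (x0 + w) (y0 - w) (y0 + w)).

Lemma edge_far z : edge z -> w <= cmod (z - a0).
Proof.
move=> [_ zf].
have [E|E] : `|complex.Re (z - a0)| = w \/ `|complex.Im (z - a0)| = w.
  by case: zf => E; [left|left|right|right]; rewrite raddfB /= E;
    rewrite addrC addKr ?normrN gtr0_norm.
- by rewrite -E; exact: normr_Re_le.
- by rewrite -E; exact: normr_Im_le.
Qed.

Lemma edge_far_near a z : cmod (a - a0) < w / 2 -> edge z -> w / 2 <= cmod (z - a).
Proof.
move=> aw /edge_far zw; have := ler_cmodD (z - a) (a - a0).
rewrite addrA subrK; lra.
Qed.

Let ww1 : x0 - w <= x0 + w. Proof. by have := w0; lra. Qed.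
Let ww2 : y0 - w <= y0 + w. Proof. by have := w0; lra. Qed.

Lemma kernel_continuous a b : cmod (a - a0) < w / 2 -> cmod (b - a) < w / 4 ->
  continuous_over edge (fun z => (z - b)^-1).
Proof.
move=> aw ba z ze; apply: derivable_continuous; apply: derivable_inv_sub.
rewrite -subr_eq0 -cmod_gt0.
have := edge_far_near aw ze; have := ler_cmodD (z - b) (b - a).
by have := w0; rewrite addrA subrK; lra.
Qed.

Lemma kernel2_continuous a b : cmod (a - a0) < w / 2 -> cmod (b - a) < w / 4 ->
  continuous_over edge (fun z => (z - b)^-1 ^+ 2).
Proof.
move=> aw ba z ze; have kc := kernel_continuous aw ba ze.
exact: (continuousM kc kc).
Qed.

Lemma kernel3_continuous a : cmod (a - a0) < w / 2 ->
  continuous_over edge (fun z => 2 * (z - a)^-1 ^+ 3).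
Proof.
move=> aw z ze; have aa : cmod (a - a) < w / 4 by have := w0; rewrite subrr cmod0; lra.
have kc := kernel_continuous aw aa ze; have k2c := kernel2_continuous aw aa ze.
exact: (continuousM (@cst_continuous C C _ z) (continuousM kc k2c)).
Qed.

Variables (phi : C -> C) (B : R).
Hypotheses (B0 : 0 <= B) (phiB : forall z, edge z -> cmod (phi z) <= B).
Hypothesis phic : continuous_over edge phi.

Lemma cauchy_transform_derive1 a : cmod (a - a0) < w / 2 ->
  is_derive a 1 (fun b => edge_int (fun z => phi z * (z - b)^-1))
    (edge_int (fun z => phi z * (z - a)^-1 ^+ 2)).
Proof.
move=> aw; have r0 : 0 < w / 4 by have := w0; lra.
have aa : cmod (a - a) < w / 4 by rewrite subrr cmod0.
apply: (cauchy_transform_is_derive (k := fun s => s^-1)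
  (k1 := fun s => s^-1 ^+ 2) (M := (w / 4)^-1 ^+ 3) ww1 ww2 r0 B0 _ _ phiB phic).
- by rewrite exprn_ge0// invr_ge0 ltW.
- move=> z ze; have := edge_far_near aw ze; lra.
- by move=> b ba; exact: kernel_continuous aw ba.
- exact: kernel2_continuous aw aa.
- by move=> s h; exact: inv_taylor.
Qed.

Lemma cauchy_transform_derive2 a : cmod (a - a0) < w / 2 ->
  is_derive a 1 (fun b => edge_int (fun z => phi z * (z - b)^-1 ^+ 2))
    (edge_int (fun z => phi z * (2 * (z - a)^-1 ^+ 3))).
Proof.
move=> aw; have r0 : 0 < w / 4 by have := w0; lra.
apply: (cauchy_transform_is_derive (k := fun s => s^-1 ^+ 2)
  (k1 := fun s => 2 * s^-1 ^+ 3) (M := 3 * (w / 4)^-1 ^+ 4)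
  ww1 ww2 r0 B0 _ _ phiB phic).
- by rewrite mulr_ge0// exprn_ge0// invr_ge0 ltW.
- move=> z ze; have := edge_far_near aw ze; lra.
- by move=> b ba; exact: kernel2_continuous aw ba.
- exact: kernel3_continuous aw.
- by move=> s h; exact: inv2_taylor.
Qed.

End Transform.

Lemma derivable_bounded_near f a : derivable f a 1 ->
  exists2 B, 0 <= B & \forall z \near a, cmod (f z) <= B.
Proof.
move=> /derivable_continuous/continuous_cmodP/(_ _ ltr01)[d d0 fd].
exists (cmod (f a) + 1); first by rewrite addr_ge0 ?cmod_ge0.
apply/nbhs_cmodP; exists d => // z /fd fz.
have := ler_cmodD (f z - f a) (f a); rewrite subrK; lra.
Qed.

(** By Cauchy's formula, near the centre of a small square f is the quotient of
    its Cauchy transform F by the Cauchy transform W of the constant 1, which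
    does not vanish there. Both are twice differentiable, as the kernel is. *)
Theorem holomorphic_derivable_derive1 f a : (\forall z \near a, derivable f z 1) ->
  derivable (derive1 f) a 1.
Proof.
move=> fda; have [B B0 fBa] := derivable_bounded_near (nbhs_singleton fda).
have /nbhs_cmodP[d d0 fd] : \forall z \near a, derivable f z 1 /\ cmod (f z) <= B.
  exact: filterI.
case: a fda fBa fd => x0 y0 fda _ fd.
pose w := d / 4; have w0 : 0 < w by rewrite /w; lra.
have sqd z : rect (x0 - w) (x0 + w) (y0 - w) (y0 + w) z ->
    derivable f z 1 /\ cmod (f z) <= B.
  move=> [zx zy]; apply: fd; rewrite (le_lt_trans (cmod_le_ReIm _))// !raddfB /=.
  have -> : d = 2 * w + 2 * w by rewrite /w; lra.
  have X : `|complex.Re z - x0| <= w by rewrite ler_norml; lra.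
  have Y : `|complex.Im z - y0| <= w by rewrite ler_norml; lra.
  lra.
set a : C := (x0 +i* y0)%C in fda fd *.
pose edge := frame (x0 - w) (x0 + w) (y0 - w) (y0 + w).
pose edge_int g := rint g (x0 - w) (x0 + w) (y0 - w) (y0 + w).
have fB z : edge z -> cmod (f z) <= B by move=> [/sqd[]].
have fc : continuous_over edge f by move=> z [/sqd[/derivable_continuous]].
pose one : C -> C := fun=> 1.
have oneB z : edge z -> cmod (one z) <= 1 by rewrite /one (cmod_real 1) normr1.
have onec : continuous_over edge one by move=> z _; exact: cst_continuous.
pose F b := edge_int (fun z => f z * (z - b)^-1).
pose F1 b := edge_int (fun z => f z * (z - b)^-1 ^+ 2).
pose W b := edge_int (fun z => one z * (z - b)^-1).
pose W1 b := edge_int (fun z => one z * (z - b)^-1 ^+ 2).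
have FF1 b : cmod (b - a) < w / 2 -> is_derive b 1 F (F1 b).
  exact: (cauchy_transform_derive1 w0 B0 fB fc).
have WW1 b : cmod (b - a) < w / 2 -> is_derive b 1 W (W1 b).
  exact: (cauchy_transform_derive1 w0 ler01 oneB onec).
have aw : cmod (a - a) < w / 2 by rewrite subrr cmod0; lra.
have [F1d _] := cauchy_transform_derive2 w0 B0 fB fc aw.
have [W1d _] := cauchy_transform_derive2 w0 ler01 oneB onec aw.
have Wa : W a != 0.
  rewrite /W /one /edge_int; under eq_fun do rewrite mul1r.
  exact: rint_winding_neq0.
have FfW b : cmod (b - a) < w / 2 -> F b = f b * W b.
  move=> bw; rewrite /F /edge_int cauchy_rint.
  - by rewrite /W /one /edge_int; under [in RHS]eq_fun do rewrite mul1r.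
  - have := normr_Re_le (b - a); rewrite raddfB /= => H.
    by have := le_lt_trans H bw; rewrite ltr_norml; lra.
  - have := normr_Im_le (b - a); rewrite raddfB /= => H.
    by have := le_lt_trans H bw; rewrite ltr_norml; lra.
  - by move=> z /sqd[].
have near_a (P : C -> Prop) : (forall b, cmod (b - a) < w / 2 -> P b) ->
    \forall b \near a, P b.
  by move=> HP; apply/nbhs_cmodP; exists (w / 2) => //; lra.
have Wc : {for a, continuous W} by case: (WW1 a aw) => /derivable_continuous.
have Wn : \forall b \near a, W b != 0.
  have /continuous_cmodP/(_ (cmod (W a))) := Wc; rewrite cmod_gt0 => /(_ Wa)[e e0 We].
  apply/nbhs_cmodP; exists e => // b /We; apply: contraTneq => ->.
  by rewrite sub0r cmodN ltxx.
(* This is F' = (f W)' = f' W + f W', solved for f'. *)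
have fderive : \forall b \near a, (F1 b - f b * W1 b) / W b = derive1 f b.
  have in_ball : \forall b \near a, cmod (b - a) < w / 2 by exact: near_a.
  near=> b.
  have bw : cmod (b - a) < w / 2 by near: b.
  have [Wd Wv] := WW1 b bw.
  have fb : derivable f b 1 by near: b.
  have Fb : \forall u \near b, F u = (f * W) u.
    have : \forall u \near b, cmod (u - a) < w / 2.
      apply/nbhs_cmodP; exists (w / 2 - cmod (b - a)); first lra.
      by move=> u ub; have := ler_cmodD (u - b) (b - a); rewrite addrA subrK; lra.
    by apply: filterS => u /FfW.
  have := near_eq_derive (1 : C) Fb; have [_ ->] := FF1 b bw.
  rewrite (deriveM fb Wd) Wv derive1E => ->.
  have W0 : W b != 0 by near: b.
  rewrite /GRing.scale /=; field.
  done.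
apply: near_eq_derivable fderive _.
have fa := nbhs_singleton fda.
have [Wd _] := WW1 a aw.
have d1 := derivableB F1d (derivableM fa W1d).
exact: derivableM d1 (derivableV Wa Wd).
Unshelve. all: by end_near.
Qed.

End DerivativeHolomorphic.

(** * Second-order jets of holomorphic functions of several variables *)

Section Jets.
Context {R : realType}.
Local Notation C := (Cplx R).

Lemma is_derive_line (V : normedModType C) (f : V -> C) (u e : V) (l : C) :
  is_derive u e f l <-> is_derive (0 : C) 1 (fun h : C => f (h *: e + u)) l.
Proof.
have lineE : 'D_1 (fun h : C => f (h *: e + u)) 0 = 'D_e f u.
  rewrite /derive; set q1 := fun h => h^-1 *: _; set q2 := fun h => h^-1 *: _.
  suff -> : q1 = q2 by [].
  by apply/funext => h; rewrite /q1 /q2 /= addr0 scale0r add0r [h *: 1]mulr1.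
split=> -[df dfl].
  by apply: DeriveDef; [exact: (derivable1P f u e).1 df|rewrite lineE].
by apply: DeriveDef; [exact: (derivable1P f u e).2 df|rewrite -lineE].
Qed.

(** Composition of the two linear approximations; the tolerance e is shared
    equally between their errors. *)
Lemma is_derive1_comp_cplx (f g : C -> C) (a l m : C) :
  is_derive a 1 f l -> is_derive (f a) 1 g m ->
  is_derive a 1 (fun z => g (f z)) (m * l).
Proof.
move=> /is_derive_cmodP fl /is_derive_cmodP gm; apply/is_derive_cmodP => e e0.
have l1 : 0 < cmod l + 1 by rewrite ltr_wpDl ?cmod_ge0.
have m1 : 0 < cmod m + 1 by rewrite ltr_wpDl ?cmod_ge0.
have [e1 [e10 e11 e1e]] := pos_lower_bound ltr01
  (divr_gt0 (divr_gt0 e0 (ltr0Sn R 1)) m1).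
have [d1 d10 fd] := fl e1 e10.
have [d2 d20 gd] := gm (e / 2 / (cmod l + 1))
  (divr_gt0 (divr_gt0 e0 (ltr0Sn R 1)) l1).
have [d [d0 dd1 dd2]] := pos_lower_bound d10 (divr_gt0 d20 l1).
exists d => // h hd; have h0 := cmod_ge0 h.
have fh := fd h (lt_le_trans hd dd1).
pose k := f (a + h) - f a.
have kh : cmod k <= (cmod l + 1) * cmod h.
  have := ler_cmodD (k - l * h) (l * h); rewrite subrK cmodM.
  move=> /le_trans -> //; rewrite mulrDl mul1r addrC lerD2l (le_trans fh)//.
  by rewrite ler_piMl.
have kd : cmod k < d2.
  rewrite (le_lt_trans kh)// mulrC -ltr_pdivlMr//; exact: lt_le_trans dd2.
have := gd k kd; rewrite /k (addrC (f a)) subrK -/k => gk.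
have -> : g (f (a + h)) - g (f a) - m * l * h =
    (g (f (a + h)) - g (f a) - m * k) + m * (k - l * h) by ring.
rewrite (le_trans (ler_cmodD _ _))// cmodM [e]splitr mulrDl lerD//.
  rewrite (le_trans gk)// -mulrA -ler_pdivlMl ?divr_gt0//.
  by rewrite mulKf ?gt_eqF ?divr_gt0// mulrC ler_pdivrMr// mulrC.
rewrite (le_trans (ler_wpM2l (cmod_ge0 m) fh))// mulrA ler_wpM2r//.
move: e1e; rewrite ler_pdivlMr// => /(le_trans _) -> //.
rewrite mulrC; apply: ler_wpM2l; [exact: ltW|lra].
Qed.

Lemma is_derive_comp (V : normedModType C) (f : V -> C) (g : C -> C) (u e : V)
    (l m : C) :
  is_derive u e f l -> is_derive (f u) 1 g m ->
  is_derive u e (fun x => g (f x)) (m * l).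
Proof.
move=> /is_derive_line fl gm; apply/is_derive_line.
apply: (is_derive1_comp_cplx (f := fun h => f (h *: e + u))) fl _.
by rewrite scale0r add0r.
Qed.

Context {n : nat}.
Local Notation V := 'cV[C]_n.
Implicit Types (phi psi : V -> C) (v : V) (D : 'I_n -> C) (H : 'I_n -> 'I_n -> C).

(** phi is holomorphic to second order at v: D and H list its first and second
    complex partial derivatives there; H k l differentiates along k, then l. *)
Definition jet phi v D H : Prop :=
  {for v, continuous phi} /\
  exists D' : 'I_n -> V -> C,
    [/\ \forall u \near v, forall k, is_derive u (delta_mx k 0) phi (D' k u),
        forall k, D' k v = D k &
        forall k l, is_derive v (delta_mx l 0) (D' k) (H k l)].

Lemma jet_cst (c : C) v : jet (fun=> c) v (fun=> 0) (fun _ _ => 0).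
Proof.
split; first exact: cst_continuous.
exists (fun _ _ => 0); split=> // [|k l]; last exact: is_derive_cst.
by apply: (@filterE _ (nbhs v)) => u k; exact: is_derive_cst.
Qed.

Lemma jetD phi psi v D D2 H H2 : jet phi v D H -> jet psi v D2 H2 ->
  jet (fun u => phi u + psi u) v (fun k => D k + D2 k) (fun k l => H k l + H2 k l).
Proof.
move=> [pc [E [pE ED EH]]] [qc [E2 [qE ED2 EH2]]]; split.
  exact: (continuousD pc qc).
exists (fun k u => E k u + E2 k u); split=> [|k|k l]; last 2 first.
- by rewrite ED ED2.
- exact: (is_deriveD (EH k l) (EH2 k l)).
apply: (@filterS2 _ (nbhs v) _ _ _ _ _ pE qE) => u pu qu k.
exact: (is_deriveD (pu k) (qu k)).
Qed.

Lemma jetZ (c : C) phi v D H : jet phi v D H ->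
  jet (fun u => c * phi u) v (fun k => c * D k) (fun k l => c * H k l).
Proof.
move=> [pc [E [pE ED EH]]]; split.
  exact: (continuousM (@cst_continuous _ _ c v) pc).
exists (fun k u => c * E k u); split=> [|k|k l]; last 2 first.
- by rewrite ED.
- exact: (is_deriveZ c (EH k l)).
by apply: (@filterS _ (nbhs v) _ _ _ _ pE) => u pu k; exact: (is_deriveZ c (pu k)).
Qed.

Lemma jet_sum (I : Type) (s : seq I) (phi : I -> V -> C) v
    (D : I -> 'I_n -> C) (H : I -> 'I_n -> 'I_n -> C) :
  (forall i, jet (phi i) v (D i) (H i)) ->
  jet (fun u => \sum_(i <- s) phi i u) v (fun k => \sum_(i <- s) D i k)
    (fun k l => \sum_(i <- s) H i k l).
Proof.
move=> phiJ; elim: s => [|i s IH].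
  under eq_fun do rewrite big_nil.
  rewrite (_ : (fun k => _) = fun=> 0); last by apply/funext => k; rewrite big_nil.
  rewrite [X in jet _ _ _ X](_ : _ = fun _ _ => 0); first exact: jet_cst.
  by apply/funext => k; apply/funext => l; rewrite big_nil.
under eq_fun do rewrite big_cons.
rewrite (_ : (fun k => _) = fun k => D i k + \sum_(j <- s) D j k); last first.
  by apply/funext => k; rewrite big_cons.
rewrite [X in jet _ _ _ X](_ : _ =
  fun k l => H i k l + \sum_(j <- s) H j k l); first exact: jetD.
by apply/funext => k; apply/funext => l; rewrite big_cons.
Qed.

Lemma jet_coord (i : 'I_n) v :
  jet (fun u => u i 0) v (fun k => (i == k)%:R) (fun _ _ => 0).
Proof.
split; first exact: coord_continuous.
exists (fun k _ => (i == k)%:R); split=> // [|k l]; last exact: is_derive_cst.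
apply: (@filterE _ (nbhs v)) => u k.
split; first exact/diff_derivable/differentiable_coord.
apply: cvg_lim => //; apply: cvg_near_cst; apply/nbhs_cmodP.
exists 1 => // h _ h0; rewrite /= !mxE addrK eqxx andbT.
by rewrite [_ *: _]mulrA mulVf// mul1r.
Qed.

(** The factor derive1 g (phi u) of the first derivatives is differentiated once
    more, which rests on derivatives of holomorphic functions being holomorphic. *)
Lemma jet_comp (g : C -> C) phi v D H : jet phi v D H ->
  (\forall c \near phi v, derivable g c 1) ->
  jet (fun u => g (phi u)) v (fun k => derive1 g (phi v) * D k)
    (fun k l => derive1n 2 g (phi v) * D k * D l + derive1 g (phi v) * H k l).
Proof.
move=> [pc [E [pE ED EH]]] gd.
have g'd := holomorphic_derivable_derive1 gd.
have gphi : \forall u \near v, derivable g (phi u) 1 by exact: pc gd.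
have is_g c : derivable g c 1 -> is_derive c 1 g (derive1 g c).
  by move=> gc; rewrite derive1E; exact: derivableP.
have pv := nbhs_singleton pE.
split; first exact: (continuous_comp pc (derivable_continuous (nbhs_singleton gd))).
exists (fun k u => derive1 g (phi u) * E k u); split=> [|k|k l].
- apply: (@filterS2 _ (nbhs v) _ _ _ _ _ pE gphi) => u pu gu k.
  exact: is_derive_comp (pu k) (is_g _ gu).
- by rewrite ED.
have g'l : is_derive v (delta_mx l 0) (fun u => derive1 g (phi u))
    (derive1n 2 g (phi v) * D l).
  rewrite -ED; apply: is_derive_comp (pv l) _.
  by rewrite /derive1n /= derive1E; exact: derivableP.
have scaleE (x y e z t : C) : x *: (y : C) + e *: (z * t : C) = z * e * t + x * y.
  by rewrite -[x *: y]/(x * y) -[e *: _]/(e * _); ring.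
by have := is_deriveM g'l (EH k l); rewrite ED scaleE.
Qed.

End Jets.

(** * Wirtinger calculus *)

Section WirtingerCalculus.
Context {R : realType}.
Local Notation C := (Cplx R).

Lemma conjCM (x y : C) : (x * y)^* = x^* * y^*.
Proof. exact: rmorphM. Qed.

Lemma conjCD (x y : C) : (x + y)^* = x^* + y^*. Proof. exact: rmorphD. Qed.

Lemma conjCB (x y : C) : (x - y)^* = x^* - y^*. Proof. exact: rmorphB. Qed.

Lemma conjC_sum (I : Type) (s : seq I) (F : I -> C) :
  (\sum_(i <- s) F i)^* = \sum_(i <- s) (F i)^*.
Proof. exact: rmorph_sum. Qed.

Definition is_rderive (f : R -> C) (s : R) (d : C) : Prop :=
  is_derive s 1 (fun x => complex.Re (f x)) (complex.Re d) /\
  is_derive s 1 (fun x => complex.Im (f x)) (complex.Im d).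

Lemma is_rderiveP (f : R -> C) s d : is_rderive f s d ->
  rderivable f s /\ rderive f s = d.
Proof.
move=> [[dR eR] [dI eI]]; split; first exact: conj dR dI.
by rewrite /rderive !derive1E eR eI; case: d {eR eI}.
Qed.

Lemma is_rderiveD (f g : R -> C) s d e : is_rderive f s d -> is_rderive g s e ->
  is_rderive (fun x => f x + g x) s (d + e).
Proof.
move=> [fR fI] [gR gI]; split; rewrite raddfD /=.
- under eq_fun do rewrite raddfD /=; exact: (is_deriveD fR gR).
- under eq_fun do rewrite raddfD /=; exact: (is_deriveD fI gI).
Qed.

Lemma is_rderiveM (f g : R -> C) s d e : is_rderive f s d -> is_rderive g s e ->
  is_rderive (fun x => f x * g x) s (d * g s + f s * e).
Proof.
have ReM (x y : C) : complex.Re (x * y) =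
  complex.Re x * complex.Re y - complex.Im x * complex.Im y by case: x; case: y.
have ImM (x y : C) : complex.Im (x * y) =
  complex.Re x * complex.Im y + complex.Im x * complex.Re y by case: x; case: y.
move=> [fR fI] [gR gI]; split; rewrite raddfD /= ?ReM ?ImM.
- under eq_fun do rewrite ReM.
  apply: is_derive_eq (is_deriveB (is_deriveM fR gR) (is_deriveM fI gI)) _.
  by rewrite /GRing.scale /=; ring.
- under eq_fun do rewrite ImM.
  apply: is_derive_eq (is_deriveD (is_deriveM fR gI) (is_deriveM fI gR)) _.
  by rewrite /GRing.scale /=; ring.
Qed.

Lemma is_rderive_conj (f : R -> C) s d : is_rderive f s d ->
  is_rderive (fun x => (f x)^*) s d^*.
Proof.
have ReJ (x : C) : complex.Re x^* = complex.Re x by case: x.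
have ImJ (x : C) : complex.Im x^* = - complex.Im x by case: x.
move=> [fR fI]; split; rewrite ?ReJ ?ImJ.
- by under eq_fun do rewrite ReJ.
- by under eq_fun do rewrite ImJ; exact: (is_deriveN fI).
Qed.

Lemma is_rderive_cst (c : C) s : is_rderive (fun=> c) s 0.
Proof. by split; exact: is_derive_cst. Qed.

Lemma near_is_rderive (f g : R -> C) s d : (\forall x \near s, f x = g x) ->
  is_rderive f s d -> is_rderive g s d.
Proof.
move=> fg [fR fI]; split.
- by apply: near_eq_is_derive fR; apply: filterS fg => x ->.
- by apply: near_eq_is_derive fI; apply: filterS fg => x ->.
Qed.

Lemma is_derive_normP (f : R -> R) (a l : R) :
  (forall e : R, 0 < e -> exists2 d : R, 0 < d &
    forall h, `|h| < d -> `|f (a + h) - f a - l * h| <= e * `|h|) ->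
  is_derive a 1 f l.
Proof.
move=> fl.
suff fc : h^-1 *: ((f \o shift a) (h *: 1) - f a) @[h --> 0^'] --> l.
  by split; [apply/cvg_ex; exists l|exact/cvg_lim].
apply/cvgrPdist_lt => e e0.
have [d d0 fd] := fl (e / 2) (divr_gt0 e0 (ltr0Sn _ 1)).
apply/nbhs_normP; exists d => // h /=; rewrite distrC subr0 => hd h0.
have h0' : 0 < `|h| by rewrite normr_gt0.
rewrite distrC -(ltr_pM2r h0') -normrM.
rewrite /GRing.scale /= mulr1 (addrC h) mulrBl mulrAC mulVf// mul1r.
by rewrite (le_lt_trans (fd h hd))// ltr_pM2r//; lra.
Qed.

Lemma is_rderive_cmodP (f : R -> C) (a : R) (l : C) :
  (forall e : R, 0 < e -> exists2 d : R, 0 < d &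
    forall h : R, `|h| < d -> cmod (f (a + h) - f a - l * h%:C%C) <= e * `|h|) ->
  is_rderive f a l.
Proof.
move=> fl; split; apply: is_derive_normP => e e0; have [d d0 fd] := fl e e0;
  exists d => // h /fd; apply: le_trans.
- apply: le_trans (normr_Re_le _); rewrite !raddfB /=.
  by case: (l) => x y /=; rewrite mulr0 subr0.
- apply: le_trans (normr_Im_le _); rewrite !raddfB /=.
  by case: (l) => x y /=; rewrite mulr0 add0r.
Qed.

(** With c = 1 and c = 'i this covers both lines of the Wirtinger derivatives. *)
Lemma is_rderive_line (f : C -> C) (l c : C) : is_derive (0 : C) 1 f l ->
  is_rderive (fun s : R => f (s%:C%C * c)) 0 (l * c).
Proof.
move=> /is_derive_cmodP fl; apply: is_rderive_cmodP => e e0.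
have c1 : 0 < cmod c + 1 by rewrite ltr_wpDl ?cmod_ge0.
have [d d0 fd] := fl (e / (cmod c + 1)) (divr_gt0 e0 c1).
exists (d / (cmod c + 1)); first exact: divr_gt0.
move=> h; rewrite ltr_pdivlMr// => hd.
have hc : cmod (h%:C%C * c) <= `|h| * (cmod c + 1).
  by rewrite cmodM cmod_real ler_wpM2l// lerDl.
have := fd _ (le_lt_trans hc hd).
rewrite !add0r mul0r -[l * c * _]mulrA (mulrC c) => /le_trans -> //.
apply: (le_trans (ler_wpM2l _ hc)); first by rewrite divr_ge0// ltW.
by rewrite mulrCA divfK ?gt_eqF// mulrC.
Qed.

Section Vector.
Context {n : nat}.
Local Notation V := 'cV[C]_n.
Implicit Types (F G : V -> C) (k : 'I_n) (v u : V) (a b : C).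

(** a and b are the two Wirtinger derivatives of F: its derivatives along the
    real and the imaginary line are then a + b and 'i (a - b). *)
Definition is_wirt F k v a b : Prop :=
  is_rderive (re_line F k v) 0 (a + b) /\
  is_rderive (im_line F k v) 0 ('i * (a - b)).

Lemma is_wirtP F k v a b : is_wirt F k v a b ->
  [/\ wirtinger_derivable F k v, wirtinger F k v = a & wirtinger_conj F k v = b].
Proof.
move=> [/is_rderiveP[d1 e1] /is_rderiveP[d2 e2]].
have i2 : 'i * 'i = -1 :> C by rewrite -expr2 sqrCi.
split; first exact: conj d1 d2.
  by rewrite /wirtinger e1 e2 mulrA i2; field; rewrite ?pnatr_eq0.
by rewrite /wirtinger_conj e1 e2 mulrA i2; field; rewrite ?pnatr_eq0.
Qed.

Lemma re_line0 F k v : re_line F k v 0 = F v.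
Proof. by rewrite /re_line scale0r addr0. Qed.

Lemma im_line0 F k v : im_line F k v 0 = F v.
Proof. by rewrite /im_line mul0r scale0r addr0. Qed.

Lemma is_wirtD F G k v a b c d : is_wirt F k v a b -> is_wirt G k v c d ->
  is_wirt (fun u => F u + G u) k v (a + c) (b + d).
Proof.
move=> [F1 F2] [G1 G2]; split.
- by rewrite addrACA; exact: is_rderiveD.
- by rewrite opprD addrACA mulrDr; exact: is_rderiveD.
Qed.

Lemma is_wirtM F G k v a b c d : is_wirt F k v a b -> is_wirt G k v c d ->
  is_wirt (fun u => F u * G u) k v (a * G v + F v * c) (b * G v + F v * d).
Proof.
move=> [F1 F2] [G1 G2]; split.
- have := is_rderiveM F1 G1; rewrite !re_line0.
  by congr is_rderive; ring.
- have := is_rderiveM F2 G2; rewrite !im_line0.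
  by congr is_rderive; ring.
Qed.

Lemma is_wirt_conj F k v a b : is_wirt F k v a b ->
  is_wirt (fun u => (F u)^*) k v b^* a^*.
Proof.
move=> [F1 F2]; split.
- by have := is_rderive_conj F1; rewrite rmorphD addrC.
- have := is_rderive_conj F2.
  have -> : ('i * (a - b))^* = 'i * (b^* - a^*).
    have -> : ('i * (a - b))^* = ('i : C)^* * (a^* - b^*).
      by rewrite -rmorphB -rmorphM.
    by rewrite (conjCi C) mulNr -mulrN opprB.
  by [].
Qed.

Lemma is_wirt_cst c k v : is_wirt (fun=> c) k v 0 0.
Proof.
by split; rewrite ?subr0 ?addr0 ?mulr0; exact: is_rderive_cst.
Qed.

Lemma is_wirt_holo F k v l : is_derive v (delta_mx k 0) F l -> is_wirt F k v l 0.
Proof.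
move=> /is_derive_line Fl; split.
- have := is_rderive_line 1 Fl; rewrite addr0 mulr1.
  by congr is_rderive; apply/funext => s; rewrite /re_line mulr1 addrC.
- have := is_rderive_line 'i Fl; rewrite subr0 mulrC.
  by congr is_rderive; apply/funext => s; rewrite /im_line addrC.
Qed.

Lemma near_line (P : V -> Prop) v (c : C) k : (\forall u \near v, P u) ->
  \forall s \near (0 : R), P (v + (s%:C%C * c) *: delta_mx k 0).
Proof.
move=> Pv; have c1 : 0 < cmod c + 1 by rewrite ltr_wpDl ?cmod_ge0.
have [e /= e0 vP] := (nbhs_ballP _ _).1 Pv.
have re : e = (complex.Re e)%:C%C by rewrite RRe_real// gtr0_real.
have r0 : 0 < complex.Re e by rewrite -ltcR -re.
apply/nbhs_normP; exists (complex.Re e / (cmod c + 1)); first exact: divr_gt0.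
move=> s /=; rewrite distrC subr0 ltr_pdivlMr// => sd; apply: vP; split=> // i j.
rewrite /ball /= !mxE opprD addNKr normrN normr_cmod re ltcR.
apply: le_lt_trans sd; rewrite !cmodM cmod_real -mulrA ler_wpM2l//.
case: (_ && _); rewrite ?cmod0 ?mulr0 ?ltW//.
by rewrite (cmod_real 1) normr1 mulr1; lra.
Qed.

Lemma near_is_wirt F G k v a b : (\forall u \near v, F u = G u) ->
  is_wirt F k v a b -> is_wirt G k v a b.
Proof.
move=> FG [F1 F2]; split.
- apply: near_is_rderive F1; have := near_line 1 k FG.
  by apply: filterS => s; rewrite mulr1.
- by apply: near_is_rderive F2; exact: near_line 'i k FG.
Qed.

(** P and Q are the fields of first Wirtinger derivatives of F near v; A and B
    are the entries of its Hessian matrices [hess_ww] and [hess_bw]. For a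
    real-valued F those of [hess_bb] and [hess_wb] are their conjugates, which
    is part of the definition. *)
Definition wjet F v (A B : 'I_n -> 'I_n -> C) : Prop :=
  exists P Q : 'I_n -> V -> C,
    (\forall u \near v, forall k, is_wirt F k u (P k u) (Q k u)) /\
    forall k l,
      is_wirt (fun u => (P k u)^*) l v (A k l) (B k l) /\
      is_wirt (fun u => (Q k u)^*) l v (B k l)^* (A k l)^*.

Lemma wjet_cst (c : C) v : wjet (fun=> c) v (fun _ _ => 0) (fun _ _ => 0).
Proof.
exists (fun _ _ => 0), (fun _ _ => 0); split.
  by apply: (@filterE _ (nbhs v)) => u k; exact: is_wirt_cst.
by move=> k l; rewrite conjC0; split; exact: is_wirt_cst.
Qed.

Lemma wjetD F G v A B A' B' : wjet F v A B -> wjet G v A' B' ->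
  wjet (fun u => F u + G u) v (fun k l => A k l + A' k l)
    (fun k l => B k l + B' k l).
Proof.
move=> [P [Q [FPQ PQ]]] [P' [Q' [GPQ PQ']]].
exists (fun k u => P k u + P' k u), (fun k u => Q k u + Q' k u); split.
  apply: (@filterS2 _ (nbhs v) _ _ _ _ _ FPQ GPQ) => u Fu Gu k.
  exact: is_wirtD.
move=> k l; have [[P1 Q1] [P2 Q2]] := (PQ k l, PQ' k l).
by split; under eq_fun do rewrite rmorphD; rewrite ?rmorphD; exact: is_wirtD.
Qed.

Lemma wjet_sum (I : Type) (s : seq I) (F : I -> V -> C) v
    (A B : I -> 'I_n -> 'I_n -> C) :
  (forall i, wjet (F i) v (A i) (B i)) ->
  wjet (fun u => \sum_(i <- s) F i u) v (fun k l => \sum_(i <- s) A i k l)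
    (fun k l => \sum_(i <- s) B i k l).
Proof.
move=> FJ; elim: s => [|i s IH].
  have e0 (X : I -> 'I_n -> 'I_n -> C) :
      (fun k l => \sum_(i <- [::]) X i k l) = fun _ _ => 0.
    by apply/funext => k; apply/funext => l; rewrite big_nil.
  by under eq_fun do rewrite big_nil; rewrite !e0; exact: wjet_cst.
have e1 (X : I -> 'I_n -> 'I_n -> C) : (fun k l => \sum_(j <- i :: s) X j k l) =
    fun k l => X i k l + \sum_(j <- s) X j k l.
  by apply/funext => k; apply/funext => l; rewrite big_cons.
by under eq_fun do rewrite big_cons; rewrite !e1; exact: wjetD.
Qed.

Lemma wjetZ (c : C) F v A B : c^* = c -> wjet F v A B ->
  wjet (fun u => c * F u) v (fun k l => c * A k l) (fun k l => c * B k l).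
Proof.
move=> cr [P [Q [FPQ PQ]]].
have Z G k u a b : is_wirt G k u a b ->
    is_wirt (fun x => c * G x) k u (c * a) (c * b).
  by move=> /(is_wirtM (is_wirt_cst c k u)); rewrite !mul0r !add0r.
exists (fun k u => c * P k u), (fun k u => c * Q k u); split.
  by apply: (@filterS _ (nbhs v) _ _ _ _ FPQ) => u Fu k; exact: Z.
move=> k l; have [P1 Q1] := PQ k l.
by split; under eq_fun do rewrite conjCM cr; rewrite ?conjCM ?cr; exact: Z.
Qed.

(** In |y - d|^2 = (y - d) (y - d)^* the first factor is holomorphic and the
    second antiholomorphic, so that each Wirtinger derivative acts on one factor
    only. *)
Lemma wjet_sqr_dist (y : V -> C) (d : C) v D H : jet y v D H ->
  wjet (fun u => `|y u - d| ^+ 2) v (fun k l => (D k)^* * D l)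
    (fun k l => (y v - d) * (H k l)^*).
Proof.
move=> [_ [E [yE ED EH]]].
have yd u : (forall k, is_derive u (delta_mx k 0) y (E k u)) ->
    forall k, is_wirt (fun u => y u - d) k u (E k u) 0.
  move=> yu k; have := is_wirtD (is_wirt_holo (yu k)) (is_wirt_cst (- d) k u).
  by rewrite !addr0.
exists (fun k u => E k u * (y u - d)^*), (fun k u => (y u - d) * (E k u)^*); split.
  apply: (@filterS _ (nbhs v) _ _ _ _ yE) => u yu k.
  under eq_fun do rewrite normCK.
  have := is_wirtM (yd u yu k) (is_wirt_conj (yd u yu k)).
  by rewrite conjC0 mulr0 mul0r addr0 add0r.
move=> k l; have yl := yd v (nbhs_singleton yE) l.
have El := is_wirt_holo (EH k l).
split.
- under eq_fun do rewrite conjCM conjCK mulrC.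
  have := is_wirtM yl (is_wirt_conj El).
  by rewrite conjC0 mulr0 addr0 mul0r add0r !ED mulrC.
- under eq_fun do rewrite conjCM conjCK.
  have := is_wirtM (is_wirt_conj yl) El.
  by rewrite conjC0 mulr0 addr0 mul0r add0r !conjCM !conjCK !ED (mulrC (D k)).
Qed.

Lemma wjetP F v A B : wjet F v A B ->
  [/\ twice_wirtinger_derivable F v,
      forall k l, hess_ww F v k l = A k l,
      forall k l, hess_bw F v k l = B k l,
      hess_wb F v = map_mx Num.conj (hess_bw F v) &
      hess_bb F v = map_mx Num.conj (hess_ww F v)].
Proof.
move=> [P [Q [FPQ PQ]]].
have nearP k : \forall u \near v, (P k u)^* = (wirtinger F k u)^*.
  by apply: (@filterS _ (nbhs v) _ _ _ _ FPQ) => u /(_ k)/is_wirtP[_ -> _].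
have nearQ k : \forall u \near v, (Q k u)^* = (wirtinger_conj F k u)^*.
  by apply: (@filterS _ (nbhs v) _ _ _ _ FPQ) => u /(_ k)/is_wirtP[_ _ ->].
have W k l : is_wirt (fun u => (wirtinger F k u)^*) l v (A k l) (B k l).
  by apply: near_is_wirt (nearP k) _; have [] := PQ k l.
have Wc k l : is_wirt (fun u => (wirtinger_conj F k u)^*) l v (B k l)^* (A k l)^*.
  by apply: near_is_wirt (nearQ k) _; have [] := PQ k l.
have gradE k : (fun u => ((grad F u)^t*) k 0) = (fun u => (wirtinger F k u)^*).
  by apply/funext => u; rewrite !mxE.
have gradcE k : (fun u => ((grad_conj F u)^t*) k 0) =
    (fun u => (wirtinger_conj F k u)^*).
  by apply/funext => u; rewrite !mxE.
have ww k l : hess_ww F v k l = A k l.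
  by rewrite mxE gradE; have [_ ->] := is_wirtP (W k l).
have bw k l : hess_bw F v k l = B k l.
  by rewrite mxE gradE; have [_ _ ->] := is_wirtP (W k l).
split; [split|exact: ww|exact: bw| |].
- by apply: (@filterS _ (nbhs v) _ _ _ _ FPQ) => u Fu k; have [] := is_wirtP (Fu k).
- by move=> k l; have [? _ _] := is_wirtP (W k l); have [? _ _] := is_wirtP (Wc k l).
- apply/matrixP => k l; rewrite [RHS]mxE bw mxE gradcE.
  by have [_ ->] := is_wirtP (Wc k l).
- apply/matrixP => k l; rewrite [RHS]mxE ww mxE gradcE.
  by have [_ _ ->] := is_wirtP (Wc k l).
Qed.

End Vector.
End WirtingerCalculus.

(** * Backward recursions as derivatives of the outputs *)

Section ConjugateSymmetry.
Context {R : realType}.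
Local Notation C := (Cplx R).

Lemma cmod_conj (z : C) : cmod z^* = cmod z.
Proof. by case: z => x y; rewrite /cmod /= sqrrN. Qed.

(** Conjugating both the argument and the value of f preserves its difference
    quotients up to conjugation. *)
Lemma is_derive_conj (f : C -> C) (c l : C) :
  (\forall z \near c, (f z)^* = f z^*) -> is_derive c 1 f l ->
  is_derive c^* 1 f l^*.
Proof.
move=> /nbhs_cmodP[r r0 fJ] /is_derive_cmodP fl.
apply/is_derive_cmodP => e e0; have [d d0 fd] := fl e e0.
have [s [s0 sr sd]] := pos_lower_bound r0 d0.
exists s => // h hs.
have hJ : cmod h^* < s by rewrite cmod_conj.
have ch : c^* + h = (c + h^*)^* by rewrite conjCD conjCK.
rewrite ch -!fJ; last 2 first.
- by rewrite subrr cmod0.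
- by rewrite addrAC subrr add0r (lt_le_trans hJ).
have := fd _ (lt_le_trans hJ sd); rewrite -(cmod_conj (_ - _)) (cmod_conj h).
by rewrite !conjCB conjCM conjCK.
Qed.

Lemma derive1_conj (f : C -> C) (D : set C) : open D -> holomorphic_on D f ->
  (forall z, D z -> (f z)^* = f z^*) ->
  forall z, D z -> (derive1 f z)^* = derive1 f z^*.
Proof.
move=> oD fD fJ z Dz.
have nD : \forall u \near z, D u by exact: open_nbhs_nbhs.
have fz : is_derive z 1 f (derive1 f z) by rewrite derive1E; exact/derivableP/fD.
have nJ : \forall u \near z, (f u)^* = f u^* by apply: filterS nD => u /fJ.
by have [_ <-] := is_derive_conj nJ fz; rewrite derive1E.
Qed.

Lemma holomorphic_derive1 (f : C -> C) (D : set C) : open D ->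
  holomorphic_on D f -> holomorphic_on D (derive1 f).
Proof.
move=> oD fD z Dz; apply: holomorphic_derivable_derive1.
have nD : \forall u \near z, D u by exact: open_nbhs_nbhs.
by apply: filterS nD => u /fD.
Qed.

(** The symmetry passes to the derivative, which is again holomorphic. *)
Lemma derive1n2_conj (f : C -> C) (D : set C) : open D -> holomorphic_on D f ->
  (forall z, D z -> (f z)^* = f z^*) ->
  forall z, D z -> (derive1n 2 f z)^* = derive1n 2 f z^*.
Proof.
move=> oD fD fJ; apply: (derive1_conj oD (holomorphic_derive1 oD fD)).
exact: (derive1_conj oD fD fJ).
Qed.

End ConjugateSymmetry.

Section FiniteSums.
Context {R : realType}.
Local Notation C := (Cplx R).

Lemma sum_delta_l (I : finType) (i : I) (F : I -> C) :
  \sum_j (j == i)%:R * F j = F i.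
Proof.
rewrite (bigD1 i)//= eqxx mul1r big1 ?addr0// => j /negbTE ->.
by rewrite mul0r.
Qed.

Lemma sum_sum_mul (I J H : finType) (A : H -> I -> C) (B : H -> J -> C) :
  \sum_h (\sum_i A h i) * (\sum_j B h j) = \sum_i \sum_j \sum_h A h i * B h j.
Proof.
under eq_bigr do rewrite mulr_suml.
rewrite exchange_big; apply: eq_bigr => i _; rewrite exchange_big.
by apply: eq_bigr => h _; rewrite mulr_sumr.
Qed.

Lemma sum_delta_r (I : finType) (i : I) (F : I -> C) :
  \sum_j (i == j)%:R * F j = F i.
Proof. by rewrite -[RHS](sum_delta_l i); under eq_bigr do rewrite eq_sym. Qed.

(** The algebra of the second-order chain rule for two consecutive layers with
    weights W: J1 and S are the first and second derivatives of an output with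
    respect to the net sums of the second layer; h1 and h2 are g' and g'' at the
    net sums of the first layer; X, Y, Z are the first derivatives of the latter
    in two directions and their second derivative. *)
Lemma chain_second (I J : finType) (S : I -> I -> C) (J1 : I -> C)
    (W : I -> J -> C) (h1 h2 X Y Z : J -> C) :
  \sum_eta \sum_beta S eta beta * (\sum_j W eta j * (h1 j * X j)) *
      (\sum_b W beta b * (h1 b * Y b)) +
    \sum_eta J1 eta * (\sum_j W eta j * (h2 j * X j * Y j + h1 j * Z j)) =
  \sum_j \sum_b ((\sum_eta \sum_beta S eta beta * W eta j * W beta b) *
      h1 j * h1 b + (j == b)%:R * ((\sum_eta J1 eta * W eta j) * h2 j)) *
      X j * Y b +
    \sum_j (\sum_eta J1 eta * W eta j) * h1 j * Z j.
Proof.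
have -> : \sum_eta J1 eta *
      (\sum_j W eta j * (h2 j * X j * Y j + h1 j * Z j)) =
    \sum_j (\sum_eta J1 eta * W eta j) * h2 j * X j * Y j +
    \sum_j (\sum_eta J1 eta * W eta j) * h1 j * Z j.
  under eq_bigr do rewrite mulr_sumr.
  rewrite exchange_big -big_split; apply: eq_bigr => j _ /=.
  by rewrite !mulr_suml -big_split; apply: eq_bigr => eta _ /=; ring.
rewrite addrA; congr (_ + _).
under [RHS]eq_bigr => j _.
  under eq_bigr do rewrite mulrDl mulrDl -!mulrA.
  rewrite big_split /= sum_delta_r; over.
rewrite big_split /=; congr (_ + _); last by apply: eq_bigr => j _; rewrite !mulrA.
have -> : \sum_j \sum_b (\sum_eta \sum_beta S eta beta * W eta j * W beta b) *
      (h1 j * (h1 b * (X j * Y b))) =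
    \sum_j \sum_b \sum_eta \sum_beta
      S eta beta * (W eta j * (h1 j * X j)) * (W beta b * (h1 b * Y b)).
  apply: eq_bigr => j _; apply: eq_bigr => b _; rewrite mulr_suml.
  apply: eq_bigr => eta _; rewrite mulr_suml; apply: eq_bigr => beta _; ring.
under [RHS]eq_bigr do rewrite exchange_big.
rewrite [RHS]exchange_big; apply: eq_bigr => eta _ /=.
under [RHS]eq_bigr do rewrite exchange_big.
rewrite [RHS]exchange_big; apply: eq_bigr => beta _ /=.
rewrite -mulrA mulr_suml mulr_sumr; apply: eq_bigr => j _; rewrite !mulr_sumr.
by apply: eq_bigr => b _; ring.
Qed.

End FiniteSums.

Section OutputDerivatives.
Context {R : realType}.
Local Notation C := (Cplx R).
Context (K : nat -> nat) (g : nat -> C -> C) (L : nat).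
Context (w : @weights R K) (x : 'cV[C]_(K 0%N)).

Local Notation g1 p j := (derive1 (g p) (net g w x p j 0)).
Local Notation g2 p j := (derive1n 2 (g p) (net g w x p j 0)).

(** The derivative of the output y_l with respect to the net sum of node j of
    layer p. *)
Definition output_jac : forall p, 'M[C]_(K L, K p) :=
  backward (fun p => 'M[C]_(K L, K p)) (fun p => 0) L
    (\matrix_(l, j) ((l == j)%:R * g1 L j))
    (fun p J => \matrix_(l, j) ((\sum_eta J l eta * w p eta j) * g1 p j)).

(** The second derivatives of the output y_l with respect to the net sums of
    layer p. *)
Definition output_hess (l : 'I_(K L)) : forall p, 'M[C]_(K p) :=
  backward (fun p => 'M[C]_(K p)) (fun p => 0) L
    (\matrix_(j, b) ((j == b)%:R * ((l == j)%:R * g2 L j)))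
    (fun p S => \matrix_(j, b)
       ((\sum_eta \sum_beta S eta beta * w p eta j * w p beta b) *
          g1 p j * g1 p b +
        (j == b)%:R * ((\sum_eta output_jac p.+1 l eta * w p eta j) * g2 p j))).

Lemma output_jac_top l j : output_jac L l j = (l == j)%:R * g1 L j.
Proof. by rewrite /output_jac backward_top mxE. Qed.

Lemma output_jac_step p l j : (p < L)%N ->
  output_jac p l j = (\sum_eta output_jac p.+1 l eta * w p eta j) * g1 p j.
Proof. by move=> pL; rewrite /output_jac backward_step// mxE. Qed.

Lemma output_hess_top l j b :
  output_hess l L j b = (j == b)%:R * ((l == j)%:R * g2 L j).
Proof. by rewrite /output_hess backward_top mxE. Qed.

Lemma output_hess_step p l j b : (p < L)%N -> output_hess l p j b =
  (\sum_eta \sum_beta output_hess l p.+1 eta beta * w p eta j * w p beta b) *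
    g1 p j * g1 p b +
  (j == b)%:R * ((\sum_eta output_jac p.+1 l eta * w p eta j) * g2 p j).
Proof. by move=> pL; rewrite /output_hess backward_step// mxE. Qed.

Lemma backward_ind (P : nat -> Prop) : P L ->
  (forall p, (0 < p < L)%N -> P p.+1 -> P p) ->
  forall p, (0 < p <= L)%N -> P p.
Proof.
move=> PL Pstep p /andP[p0 pL].
have : forall k, (k < L)%N -> P (L - k)%N.
  elim=> [|k IH] kL; first by rewrite subn0.
  by apply: Pstep; [lia|rewrite subnSK; [exact/IH/ltnW|exact: ltnW]].
by move=> PLk; rewrite -(subKn pL); apply: PLk; lia.
Qed.

Section Conjugates.
Hypothesis g1J : forall p j, (0 < p <= L)%N ->
  derive1 (g p) (net g w x p j 0)^* = (g1 p j)^*.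
Hypothesis g2J : forall p j, (0 < p <= L)%N ->
  derive1n 2 (g p) (net g w x p j 0)^* = (g2 p j)^*.

(** The recursion for [output_jac] multiplied by its conjugate. *)
Lemma gammaE p : (0 < p <= L)%N -> forall j b,
  gamma g L w x p j b = \sum_l (output_jac p l j)^* * output_jac p l b.
Proof.
move=> pL; have LL : (0 < L <= L)%N by lia.
move: p pL.
apply: backward_ind => [j b|p pL IH j b].
  rewrite /gamma backward_top mxE.
  under eq_bigr do rewrite !output_jac_top conjCM conjC_nat -mulrA.
  rewrite sum_delta_l; have [->|jb] := eqVneq j b; last by rewrite mul0r mulr0.
  by rewrite mul1r g1J.
have /andP[p0 pltL] := pL.
rewrite /gamma backward_step// -/(gamma g L w x p.+1) mxE.
have -> : \sum_l (output_jac p l j)^* * output_jac p l b =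
    (\sum_eta \sum_beta (\sum_l (output_jac p.+1 l eta)^* * output_jac p.+1 l beta) *
      (w p eta j)^* * w p beta b) * (g1 p j)^* * g1 p b.
  under eq_bigr => l _.
    rewrite !output_jac_step// conjCM.
    rewrite mulrACA conjC_sum; under eq_bigr do rewrite conjCM.
    over.
  rewrite -mulr_suml sum_sum_mul mulrA; congr (_ * _ * _).
  apply: eq_bigr => eta _; apply: eq_bigr => beta _; rewrite !mulr_suml.
  by apply: eq_bigr => l _; ring.
rewrite g1J; last lia.
congr (_ * _ * _); apply: eq_bigr => eta _; apply: eq_bigr => beta _.
by rewrite IH.
Qed.

Context (d : 'cV[C]_(K L)).
Local Notation res l := (layer g w x L l 0 - d l 0).

Lemma error_signalE p : (0 < p <= L)%N -> forall j,
  error_signal g w x d p j 0 = \sum_l res l * (output_jac p l j)^*.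
Proof.
move=> pL; have LL : (0 < L <= L)%N by lia.
move: p pL; apply: backward_ind => [j|p pL IH j].
  rewrite /error_signal backward_top mxE g1J//.
  under eq_bigr do rewrite output_jac_top conjCM conjC_nat mulrCA.
  by rewrite sum_delta_l.
have /andP[p0 pltL] := pL.
rewrite /error_signal backward_step// -/(error_signal g w x d p.+1) mxE g1J; last lia.
under [in RHS]eq_bigr => l _.
  rewrite output_jac_step// conjCM conjC_sum.
  under eq_bigr do rewrite conjCM.
  rewrite mulrA mulr_sumr; over.
rewrite -mulr_suml; congr (_ * _); rewrite exchange_big.
apply: eq_bigr => eta _; rewrite IH mulr_suml.
by apply: eq_bigr => l _; rewrite mulrA.
Qed.

(** This is why theta may be multiplied by the weight of either index in the
    recursion for psi. *)
Lemma theta_offdiag p : (0 < p <= L)%N -> forall j b, j != b ->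
  theta g w x d p j b = 0.
Proof.
move: p; apply: backward_ind => [j b /negbTE jb|p /andP[_ pL] _ j b /negbTE jb].
  by rewrite /theta backward_top mxE jb.
by rewrite /theta backward_step// mxE jb.
Qed.

(** psi and theta obey separate recursions, but it is their sum that is the
    conjugated second derivative contracted with the residuals: both feed the
    recursion for psi, while theta is created anew in each layer by g''. *)
Lemma psi_thetaE p : (0 < p <= L)%N -> forall j b,
  psi g w x d p j b + theta g w x d p j b =
  \sum_l res l * (output_hess l p j b)^*.
Proof.
move=> pL; have LL : (0 < L <= L)%N by lia.
move: p pL; apply: backward_ind => [j b|p pL IH j b].
  rewrite /psi /theta !backward_top !mxE add0r.
  under eq_bigr do rewrite output_hess_top !conjCM !conjC_nat
    mulrCA [_ * (_%:R * _)]mulrCA mulrA -mulrA mulrCA.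
  rewrite sum_delta_l; have [->|jb] := eqVneq j b; last by rewrite mul0r.
  by rewrite mul1r g2J.
have /andP[p0 pltL] := pL.
have pL' : (0 < p <= L)%N by lia.
have pL1 : (0 < p.+1 <= L)%N by lia.
have thetaE : theta g w x d p j b =
    (j == b)%:R * ((\sum_eta error_signal g w x d p.+1 eta 0 * (w p eta j)^*) *
    (g2 p j)^*).
  rewrite /theta backward_step// mxE g2J//.
  by case: (j == b); rewrite ?mul1r ?mul0r.
have psiE : psi g w x d p j b = (\sum_eta \sum_beta
    (psi g w x d p.+1 eta beta + theta g w x d p.+1 eta beta) *
    (w p eta j)^* * (w p beta b)^*) * (g1 p j)^* * (g1 p b)^*.
  rewrite /psi backward_step// -/(psi g w x d p.+1) mxE !g1J//.
  congr (_ * _ * _); apply: eq_bigr => eta _; apply: eq_bigr => beta _.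
  have [->|eb] := eqVneq eta beta; first by ring.
  by rewrite (theta_offdiag pL1 eb) mul0r !addr0 mulrAC.
have -> : \sum_l res l * (output_hess l p j b)^* =
    \sum_l (\sum_eta \sum_beta res l * (output_hess l p.+1 eta beta)^* *
        (w p eta j)^* * (w p beta b)^*) * (g1 p j)^* * (g1 p b)^* +
    \sum_l (j == b)%:R * ((\sum_eta res l * (output_jac p.+1 l eta)^* *
        (w p eta j)^*) * (g2 p j)^*).
  rewrite -big_split; apply: eq_bigr => l _ /=.
  rewrite output_hess_step// conjCD.
  rewrite !conjCM conjC_nat !conjC_sum mulrDr; congr (_ + _).
    rewrite !mulrA; congr (_ * _ * _); rewrite mulr_sumr.
    apply: eq_bigr => eta _; rewrite conjC_sum mulr_sumr.
    by apply: eq_bigr => beta _; rewrite !conjCM !mulrA.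
  rewrite mulrCA; congr (_ * _); rewrite mulrA; congr (_ * _); rewrite mulr_sumr.
  by apply: eq_bigr => eta _; rewrite conjCM mulrA.
rewrite psiE thetaE; congr (_ + _).
  rewrite -!mulr_suml; congr (_ * _ * _); rewrite [RHS]exchange_big.
  apply: eq_bigr => eta _; rewrite [RHS]exchange_big; apply: eq_bigr => beta _ /=.
  by rewrite IH -!mulr_suml.
rewrite -mulr_sumr -mulr_suml; congr (_ * (_ * _)); rewrite [RHS]exchange_big.
by apply: eq_bigr => eta _; rewrite error_signalE// -mulr_suml.
Qed.

End Conjugates.
End OutputDerivatives.

(** * The outputs as functions of the weights of one layer *)

Section LayerWeights.
Context {R : realType}.
Local Notation C := (Cplx R).
Context (K : nat -> nat) (g : nat -> C -> C) (w : @weights R K).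
Context (x : 'cV[C]_(K 0%N)) (q : nat).
Local Notation n := (K q.+1 * K q)%N.
Local Notation V := 'cV[C]_n.
Implicit Types (u : V) (p : nat).

Lemma set_weights_in u : set_weights w u q = vec_mx u^T.
Proof. by rewrite /set_weights dfwithin. Qed.

Lemma set_weights_out u p : p != q -> set_weights w u p = w p.
Proof. by move=> pq; rewrite /set_weights dfwithout// eq_sym. Qed.

Lemma set_weight_vector : set_weights w (weight_vector w q) = w.
Proof.
apply: functional_extensionality_dep => p.
have [->|pq] := eqVneq p q; last exact: set_weights_out.
by rewrite set_weights_in /weight_vector trmxK mxvecK.
Qed.

Lemma weight_vector_set u : weight_vector (set_weights w u) q = u.
Proof. by rewrite /weight_vector set_weights_in vec_mxK trmxK. Qed.

Lemma layer_below u p : (p <= q)%N -> layer g (set_weights w u) x p = layer g w x p.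
Proof.
by elim: p => //= p IH pq; rewrite IH 1?ltnW// set_weights_out// ltn_eqF.
Qed.

Lemma net_at u j : net g (set_weights w u) x q.+1 j 0 =
  \sum_i layer g w x q i 0 * u (mxvec_index j i) 0.
Proof.
rewrite /= layer_below// set_weights_in mxE.
by apply: eq_bigr => i _; rewrite !mxE mulrC.
Qed.

Lemma net_above u p j : (q < p)%N -> net g (set_weights w u) x p.+1 j 0 =
  \sum_i w p j i * g p (net g (set_weights w u) x p i 0).
Proof.
case: p j => // p j qp; rewrite [LHS]mxE set_weights_out ?gtn_eqF//.
by apply: eq_bigr => i _; rewrite /= [in X in _ * X]mxE.
Qed.

Context (L : nat).
Hypothesis qL : (q < L)%N.
Local Notation v := (weight_vector w q).
Hypothesis g_near : forall p j, (0 < p <= L)%N ->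
  \forall c \near net g w x p j 0, derivable (g p) c 1.

(** The derivatives of the net sums into which the weights of the layer enter
    directly. *)
Definition net_partial (j : 'I_(K q.+1)) (k : 'I_n) : C :=
  \sum_i layer g w x q i 0 * (mxvec_index j i == k)%:R.

Lemma net_partialE j b a : net_partial j (mxvec_index b a) =
  (j == b)%:R * layer g w x q a 0.
Proof.
have idx i : (mxvec_index j i == mxvec_index b a) = (j == b) && (i == a).
  by rewrite (inj_eq (@cast_ord_inj _ _ _)) (inj_eq enum_rank_inj) xpair_eqE.
rewrite /net_partial; under eq_bigr do rewrite idx -mulnb natrM mulrC -mulrA.
by rewrite -mulr_sumr sum_delta_l.
Qed.

(** Forward propagation of the derivatives of the net sums is adjoint to the
    backward recursions of [output_jac] and [output_hess]: contracting both
    gives a value that does not depend on p, which is known for p = q + 1, where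
    the net sums are linear in the weights. *)
Lemma net_jets p : (q < p <= L)%N ->
  exists (D : 'I_(K p) -> 'I_n -> C) (H : 'I_(K p) -> 'I_n -> 'I_n -> C),
  [/\ forall j, jet (fun u => net g (set_weights w u) x p j 0) v (D j) (H j),
    forall l k, \sum_j output_jac g L w x p l j * D j k =
      \sum_j output_jac g L w x q.+1 l j * net_partial j k &
    forall l k m,
      \sum_j \sum_b output_hess g w x l p j b * D j k * D b m +
        \sum_j output_jac g L w x p l j * H j k m =
      \sum_j \sum_b output_hess g w x l q.+1 j b *
        net_partial j k * net_partial b m].
Proof.
elim: p => // p IH /andP[]; rewrite ltnS leq_eqVlt => /orP[/eqP <- _|qp pL].
  exists net_partial, (fun _ _ _ => 0); split=> // [j|l k m]; last first.
    by rewrite [X in _ + X]big1 ?addr0// => j _; rewrite mulr0.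
  under eq_fun do rewrite net_at.
  have := jet_sum (index_enum _) (fun i => jetZ (layer g w x q i 0)
    (jet_coord (mxvec_index j i) v)).
  congr jet; apply/funext => k; apply/funext => l.
  by rewrite big1// => i _; rewrite mulr0.
have pL' : (0 < p <= L)%N by lia.
have [|D [H [DH D1 D2]]] := IH; first by lia.
have gx i := jet_comp (DH i) (g := g p).
rewrite set_weight_vector in gx.
exists (fun j k => \sum_i w p j i * (derive1 (g p) (net g w x p i 0) * D i k)).
exists (fun j k m => \sum_i w p j i *
  (derive1n 2 (g p) (net g w x p i 0) * D i k * D i m +
   derive1 (g p) (net g w x p i 0) * H i k m)).
split.
- move=> j; under eq_fun do rewrite net_above//.
  exact: (jet_sum _ (fun i => jetZ (w p j i) (gx i (g_near i pL')))).
- move=> l k; rewrite -D1.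
  under [RHS]eq_bigr do rewrite output_jac_step// 2!mulr_suml.
  rewrite [RHS]exchange_big; apply: eq_bigr => eta _; rewrite mulr_sumr.
  by apply: eq_bigr => j _; ring.
- move=> l k m; rewrite -D2 chain_second.
  congr (_ + _).
    by apply: eq_bigr => j _; apply: eq_bigr => b _; rewrite output_hess_step.
  by apply: eq_bigr => j _; rewrite output_jac_step.
Qed.

(** At p = L the arrays [output_jac] and [output_hess] reduce to g' and g'' on
    the diagonal, so that [net_jets] gives the derivatives of the outputs. *)
Lemma output_jet l :
  jet (fun u => layer g (set_weights w u) x L l 0) v
    (fun k => \sum_j output_jac g L w x q.+1 l j * net_partial j k)
    (fun k m => \sum_j \sum_b output_hess g w x l q.+1 j b *
        net_partial j k * net_partial b m).
Proof.
have [|D [H [DH D1 D2]]] := @net_jets L; first by lia.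
have LL : (0 < L <= L)%N by lia.
have := jet_comp (DH l) (g := g L).
rewrite set_weight_vector => /(_ (g_near l LL)).
have -> : (fun u => layer g (set_weights w u) x L l 0) =
    (fun u => g L (net g (set_weights w u) x L l 0)).
  by apply/funext => u; case: (L) LL l {D H DH D1 D2} => // L' _ l; rewrite /= mxE.
congr jet.
  apply/funext => k; rewrite -D1.
  by under [RHS]eq_bigr do rewrite output_jac_top -mulrA; rewrite sum_delta_r.
apply/funext => k; apply/funext => m; rewrite -D2.
congr (_ + _).
  under [RHS]eq_bigr => j _.
    under eq_bigr do rewrite output_hess_top -!mulrA.
    rewrite sum_delta_r; over.
  by rewrite sum_delta_r /= -mulrA.
by under [RHS]eq_bigr do rewrite output_jac_top -mulrA; rewrite sum_delta_r.
Qed.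

End LayerWeights.

(** * The Hessian matrices of the error *)

Theorem theorem4p1 (R : realType) (L : nat) (K : nat -> nat)
    (Omega : nat -> set (Cplx R)) (g : nat -> Cplx R -> Cplx R)
    (N : nat) (z : 'I_N -> 'cV[Cplx R]_(K 0%N)) (d : 'I_N -> 'cV[Cplx R]_(K L))
    (w : @weights R K)
    (hL : (1 <= L)%N)
    (hOmega : forall p, (1 <= p <= L)%N ->
       is_domain (Omega p) /\ conj_closed (Omega p))
    (hhol : forall p, (1 <= p <= L)%N -> holomorphic_on (Omega p) (g p))
    (hconj : forall p, (1 <= p <= L)%N ->
       forall c, Omega p c -> (g p c)^* = g p c^*)
    (hnet : forall t p j, (1 <= p <= L)%N -> Omega p (net g w (z t) p j 0)) :
  (* q = p - 1, for p = 1, ..., L *)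
  forall q, (q < L)%N ->
  let E := layer_error g z d w (q := q) in
  let v := weight_vector w q in
  let Hww := hess_ww E v in
  let Hbw := hess_bw E v in
  let Hwb := hess_wb E v in
  let Hbb := hess_bb E v in
  twice_wirtinger_derivable E v /\
  (Hbb \in unitmx -> Hww - Hbw *m invmx Hbb *m Hwb \in unitmx ->
   forall mu : R,
     weight_vector (newton_update g z d mu w q) q =
     v + (mu%:C)%C *:
       (invmx (Hww - Hbw *m invmx Hbb *m Hwb) *m
        (Hbw *m invmx Hbb *m (grad_conj E v)^t* - (grad E v)^t*))) /\
  (forall (j b : 'I_(K q.+1)) (i a : 'I_(K q)),
     Hww (mxvec_index j i) (mxvec_index b a) =
     N%:R^-1 * \sum_(t < N) gamma g L w (z t) q.+1 j b *
       (layer g w (z t) q i 0)^* * layer g w (z t) q a 0) /\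
  (forall (j b : 'I_(K q.+1)) (i a : 'I_(K q)),
     Hbw (mxvec_index j i) (mxvec_index b a) =
     N%:R^-1 * \sum_(t < N)
       (psi g w (z t) (d t) q.+1 j b + theta g w (z t) (d t) q.+1 j b) *
       (layer g w (z t) q i 0)^* * (layer g w (z t) q a 0)^*) /\
  Hwb = map_mx Num.conj Hbw /\
  Hbb = map_mx Num.conj Hww.
Proof.
move=> q qL E v Hww Hbw Hwb Hbb.
have oO p : (0 < p <= L)%N -> open (Omega p) by move=> /hOmega[[]].
have g_near t p j : (0 < p <= L)%N ->
    \forall c \near net g w (z t) p j 0, derivable (g p) c 1.
  move=> pL; have := open_nbhs_nbhs (conj (oO p pL) (hnet t p j pL)).
  by apply: filterS => c; exact: hhol.
have g1J t p j : (0 < p <= L)%N -> derive1 (g p) (net g w (z t) p j 0)^* =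
    (derive1 (g p) (net g w (z t) p j 0))^*.
  move=> pL; apply/esym.
  exact: (derive1_conj (oO p pL) (hhol p pL) (hconj p pL) (hnet t p j pL)).
have g2J t p j : (0 < p <= L)%N -> derive1n 2 (g p) (net g w (z t) p j 0)^* =
    (derive1n 2 (g p) (net g w (z t) p j 0))^*.
  move=> pL; apply/esym.
  exact: (derive1n2_conj (oO p pL) (hhol p pL) (hconj p pL) (hnet t p j pL)).
have qL1 : (0 < q.+1 <= L)%N by [].
pose D t (l : 'I_(K L)) k :=
  \sum_j output_jac g L w (z t) q.+1 l j * net_partial g w (z t) j k.
pose H t (l : 'I_(K L)) k m := \sum_j \sum_b output_hess g w (z t) l q.+1 j b *
  net_partial g w (z t) j k * net_partial g w (z t) b m.
have yJ t l : jet (fun u => layer g (set_weights w u) (z t) L l 0) v (D t l) (H t l).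
  exact: output_jet qL (g_near t) l.
have N_real : (N%:R^-1 : Cplx R)^* = N%:R^-1.
  by apply/conj_Creal/ger0_real; rewrite invr_ge0 ler0n.
have EJ := wjetZ N_real (wjet_sum (index_enum _) (fun t =>
  wjet_sum (index_enum _) (fun l => wjet_sqr_dist (d t l 0) (yJ t l)))).
have [Ediff ww bw wb bb] := wjetP EJ.
have DE t l b a : D t l (mxvec_index b a) =
    output_jac g L w (z t) q.+1 l b * layer g w (z t) q a 0.
  rewrite /D; under eq_bigr do rewrite net_partialE mulrCA.
  by rewrite sum_delta_l.
have HE t l j i b a : H t l (mxvec_index j i) (mxvec_index b a) =
    output_hess g w (z t) l q.+1 j b * layer g w (z t) q i 0 *
    layer g w (z t) q a 0.
  rewrite /H; under eq_bigr => j' _.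
    under eq_bigr do rewrite !net_partialE mulrCA.
    rewrite sum_delta_l mulrCA -mulrA; over.
  by rewrite sum_delta_l; ring.
have v_layer t : layer g (set_weights w v) (z t) L = layer g w (z t) L.
  by rewrite set_weight_vector.
split; first exact: Ediff.
split; first by move=> _ _ mu; rewrite weight_vector_set.
split.
  move=> j b i a; rewrite [LHS]ww; congr (_ * _); apply: eq_bigr => t _.
  rewrite (gammaE (g1J t) qL1) !mulr_suml; apply: eq_bigr => l _.
  by rewrite !DE conjCM; ring.
split.
  move=> j b i a; rewrite [LHS]bw; congr (_ * _); apply: eq_bigr => t _.
  rewrite (psi_thetaE (g1J t) (g2J t) _ qL1) !mulr_suml; apply: eq_bigr => l _.
  by rewrite HE v_layer !conjCM; ring.
by split; [exact: wb|exact: bb].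
Qed.
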